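(* Let $p\ge3$, let $G=W_{p+1}$ be the wheel graph on $[p+1]$, and let $S=K[x_1,\dots,x_{p+1},y_1,\dots,y_{p+1}]$. Then $$\operatorname{Hilb}_{S/J_G}(t)=\frac{(1-t^2)(1+t)^{p-1}+(p-1)t^p+t^{p+1}}{(1-t)^{p+1}}+\frac{(p-1)t^2+2t}{(1-t)^{p+2}}.$$ In particular, $\dim(S/J_G)=p+2$ and $e(S/J_G)=p+1$.
   Context: $K$ is a field and $S$ is standard graded. The wheel graph $W_{p+1}$ is the join $C_p*\{v\}$ of the cycle $C_p$ on $p$ vertices with a single vertex $v$, i.e. $C_p$ together with a new vertex adjacent to all vertices of $C_p$. The binomial edge ideal of a simple graph $G$ (with totally ordered vertex set) is $J_G=(x_iy_j-x_jy_i : \{i,j\}\in E(G),\ i<j)$. $\operatorname{Hilb}_M(t)=\sum_{k\ge0}\dim_K(M_k)t^k$ is the Hilbert series, $\dim$ is Krull dimension, and $e(M)$ is the multiplicity: if $\operatorname{Hilb}_M(t)=Q(t)/(1-t)^d$ with $d=\dim M$ and $Q$ a polynomial, then $e(M)=Q(1)$. *)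

(* Defs.v *)
From HB Require Import structures.
From mathcomp Require Import all_boot all_order all_algebra ring_quotient.
From mathcomp Require Import boolp.
From mathcomp Require Import mpoly.

Set Implicit Arguments.
Unset Strict Implicit.
Unset Printing Implicit Defensive.

Import GRing.Theory.
Local Open Scope ring_scope.
Local Open Scope quotient_scope.

(** * Wheel graphs *)

Definition cycle_graph (p : nat) : rel 'I_p :=
  fun i j => (j == i.+1 %% p :> nat)%N || (i == j.+1 %% p :> nat)%N.

Definition edgeless_graph (n : nat) : rel 'I_n := fun _ _ => false.

(* The vertices of the second graph are numbered after those of the first. *)
Definition graph_join (m n : nat) (e1 : rel 'I_m) (e2 : rel 'I_n) :
    rel 'I_(m + n) :=
  fun i j => match split i, split j with
             | inl i1, inl j1 => e1 i1 j1
             | inr i2, inr j2 => e2 i2 j2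
             | _, _ => true
             end.

Definition wheel_graph (p : nat) : rel 'I_(p + 1) :=
  graph_join (@cycle_graph p) (@edgeless_graph 1).

Lemma wheel_graph_sym p : ssrbool.symmetric (@wheel_graph p).
Proof.
move=> i j; rewrite /wheel_graph /graph_join.
by case: (split i) (split j) => [a|a] [b|b] //; rewrite /cycle_graph orbC.
Qed.

Lemma wheel_graph_irrefl p : (1 < p)%N -> irreflexive (@wheel_graph p).
Proof.
move=> p1 i; rewrite /wheel_graph /graph_join.
case: (split i) => [a|a] //; rewrite /cycle_graph orbb.
have := ltn_ord a; rewrite leq_eqVlt => /orP[/eqP ap|ap].
  rewrite ap modnn; apply/eqP => a0.
  by rewrite -ap a0 in p1.
by rewrite modn_small //; apply/eqP => /n_Sn.
Qed.

(** * Binomial edge ideals *)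

Section BinomialEdgeIdeal.
Variables (K : fieldType) (n : nat).

(* K[x_1, ..., x_n, y_1, ..., y_n], with the x's numbered before the y's *)
Local Notation S := {mpoly K[n + n]}.

Definition xvar (i : 'I_n) : S := 'X_(lshift n i).
Definition yvar (i : 'I_n) : S := 'X_(rshift n i).

Variable e : rel 'I_n.

Definition in_bei (f : S) : Prop :=
  exists a : 'I_n -> 'I_n -> S,
    f = \sum_(i < n) \sum_(j < n | e i j && (i < j)%N)
          a i j * (xvar i * yvar j - xvar j * yvar i).

Definition bei : {pred S} := fun f => `[< in_bei f >].

Lemma beiP f : reflect (in_bei f) (f \in bei).
Proof. exact: asboolP. Qed.

Lemma bei_idealr_closed : idealr_closed bei.
Proof.
split.
- apply/beiP; exists (fun _ _ => 0).
  by rewrite big1 // => i _; rewrite big1 // => j _; rewrite mul0r.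
- apply/negP => /beiP[a /(congr1 (meval (fun=> 0 : K)))].
  rewrite meval1 raddf_sum big1 => [/eqP|i _]; first by rewrite oner_eq0.
  rewrite raddf_sum big1 // => j _.
  by rewrite /= mevalM mevalB !mevalM !mevalXU !mulr0 subr0 mulr0.
- move=> a f g /beiP[b ->] /beiP[c ->]; apply/beiP.
  exists (fun i j => a * b i j + c i j).
  rewrite mulr_sumr -big_split; apply: eq_bigr => i _.
  rewrite mulr_sumr -big_split; apply: eq_bigr => j _ /=.
  by rewrite mulrDl mulrA.
Qed.

HB.instance Definition _ := isIdealr.Build S bei bei_idealr_closed.

End BinomialEdgeIdeal.

(** * The algebra structure of a quotient *)

Section QuotientAlgebra.
Variables (K : comNzRingType) (A : comAlgType K) (I : idealr A).
Local Notation Q := {ideal_quot I}.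

Definition quot_scale (a : K) (u : Q) : Q := \pi_Q (a *: 1) * u.

Fact quot_scaleA a b u : quot_scale a (quot_scale b u) = quot_scale (a * b) u.
Proof.
by rewrite /quot_scale mulrA -rmorphM -scalerAl mul1r scalerA.
Qed.
Fact quot_scale1 : left_id 1 quot_scale.
Proof. by move=> u; rewrite /quot_scale scale1r rmorph1 mul1r. Qed.
Fact quot_scaleDr : right_distributive quot_scale +%R.
Proof. by move=> a u v; rewrite /quot_scale mulrDr. Qed.
Fact quot_scaleDl u : {morph quot_scale^~ u : a b / a + b}.
Proof. by move=> a b; rewrite /quot_scale scalerDl rmorphD mulrDl. Qed.

HB.instance Definition _ := GRing.Zmodule_isLmodule.Build K Q
  quot_scaleA quot_scale1 quot_scaleDr quot_scaleDl.

Fact quot_scaleAl (a : K) (u v : Q) : a *: (u * v) = (a *: u) * v.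
Proof. exact: mulrA. Qed.

HB.instance Definition _ := GRing.Lmodule_isLalgebra.Build K Q quot_scaleAl.
HB.instance Definition _ := GRing.Lalgebra_isComAlgebra.Build K Q.

Lemma pi_scale (a : K) (f : A) : \pi_Q (a *: f) = a *: \pi_Q f.
Proof.
by rewrite -[f in LHS]mul1r scalerAl rmorphM.
Qed.

End QuotientAlgebra.

(** * Power series with integer coefficients *)

(* [expand P Q k] is the coefficient of t^k in the expansion of P/Q as a power
   series, for Q with invertible constant coefficient; see [expandP]. *)
Fixpoint expand_seq (P Q : {poly int}) (k : nat) : seq int :=
  if k is k'.+1 then
    let s := expand_seq P Q k' in
    rcons s ((P`_k' - \sum_(i < k') s`_i * Q`_(k' - i)) * (Q`_0)^-1)
  else [::].

Definition expand (P Q : {poly int}) (k : nat) : int :=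
  (expand_seq P Q k.+1)`_k.

Lemma size_expand_seq (P Q : {poly int}) k : size (expand_seq P Q k) = k.
Proof. by elim: k => //= k IHk; rewrite size_rcons IHk. Qed.

Lemma nth_expand_seq (P Q : {poly int}) k i :
  (i < k)%N -> (expand_seq P Q k)`_i = expand P Q i.
Proof.
elim: k => // k IHk; rewrite ltnS leq_eqVlt => /orP[/eqP-> //|ik].
by rewrite -IHk //= nth_rcons size_expand_seq ik.
Qed.

Lemma expandP (P Q : {poly int}) k : Q`_0 \is a GRing.unit ->
  \sum_(i < k.+1) expand P Q i * Q`_(k - i) = P`_k.
Proof.
move=> Q0; rewrite big_ord_recr /= subnn.
rewrite {2}/expand /= nth_rcons size_expand_seq ltnn eqxx mulrVK //.
rewrite (eq_bigr (fun i : 'I_k => (expand_seq P Q k)`_i * Q`_(k - i))).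
  by rewrite addrC subrK.
by move=> i _; rewrite nth_expand_seq.
Qed.

(** * Hilbert series, Krull dimension and multiplicity *)

(* W is a d-dimensional subspace of V: it is the span of d independent vectors *)
Definition has_dim (K : fieldType) (V : lmodType K) (W : V -> Prop) (d : nat) :=
  exists b : 'I_d -> V,
    (forall c : 'I_d -> K, \sum_i c i *: b i = 0 -> forall i, c i = 0) /\
    (forall v, W v <-> exists c : 'I_d -> K, v = \sum_i c i *: b i).

Definition has_hilbert_series (K : fieldType) (V : lmodType K)
    (gr : nat -> V -> Prop) (H : nat -> int) :=
  forall k, exists2 d : nat, has_dim (gr k) d & H k = d%:Z.

(* Boolean predicates lose no generality here: by [asbool], every Prop-valued
   predicate is classically equivalent to one. *)
Definition prime_ideal (R : comNzRingType) (P : {pred R}) :=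
  idealr_closed P /\ prime_idealr_closed P.

(* P 0 < P 1 < ... < P d; the values of P beyond d are irrelevant. *)
Definition prime_chain (R : comNzRingType) (d : nat) (P : nat -> {pred R}) :=
  (forall i, (i <= d)%N -> prime_ideal (P i)) /\
  (forall i, (i < d)%N ->
     {subset P i <= P i.+1} /\ exists2 f, f \in P i.+1 & f \notin P i).

Definition has_krull_dim (R : comNzRingType) (d : nat) :=
  (exists P : nat -> {pred R}, prime_chain d P) /\
  (forall m (P : nat -> {pred R}), prime_chain m P -> (m <= d)%N).

Definition has_multiplicity (K : fieldType) (A : comAlgType K)
    (gr : nat -> A -> Prop) (e : int) :=
  exists d (Q : {poly int}),
    [/\ has_krull_dim A d,
        has_hilbert_series gr (expand Q ((1 - 'X) ^+ d)) &
        e = Q.[1]].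

(** * The quotient S/J_G *)

Definition bei_quot (K : fieldType) (n : nat) (e : rel 'I_n) : comAlgType K :=
  {ideal_quot (@bei K n e : idealr {mpoly K[n + n]})}.

(* The degree k piece of S/J_G is the image of that of S. *)
Definition bei_quot_gr (K : fieldType) (n : nat) (e : rel 'I_n) (k : nat)
    (u : bei_quot K e) : Prop :=
  exists2 f : {mpoly K[n + n]}, f \is k.-homog & u = \pi f.

(* Main.v *)
From HB Require Import structures.
Require Import Defs.
From mathcomp Require Import all_boot all_order all_algebra ring_quotient zify ring.
From mathcomp Require boolp.
From mathcomp Require Import mpoly.

(* J_G is generated by the differences x_i y_j - x_j y_i of monomials, so the
   classes of monomials under the moves x_i y_j -> x_j y_i along edges form a
   basis of S/J_G.  If i and j are joined by a path whose inner vertices all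
   occur in a monomial w, then w (x_i y_j - x_j y_i) lies in J_G; hence the class
   of a monomial is given by its degree at each vertex together with its x-degree
   on each connected component of its support.  For the wheel, the classes of
   degree k are of three kinds.
   - The hub occurs: the support is connected, and the class is given by the
     vertex degrees and an x-degree between 0 and k.
   - The hub does not occur, all rim vertices do, and the x-degree is neither 0
     nor k.
   - All other classes contain exactly one monomial without the hub and without
     a factor x_i y_(i+1), indices being cyclic.  Such a monomial is an arbitrary
     choice, for each i, of a power of x_i or of y_(i+1), whence the series
     ((1+t)/(1-t))^p.
   For the dimension, choose f_i in P_(i+1) but not in P_i along a chain of primes
   P_0 < ... < P_m: the f_i are algebraically independent modulo P_0, and comparing
   the number of monomials in the f_i with the Hilbert series gives m <= d. *)

Set Implicit Arguments.
Unset Strict Implicit.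
Unset Printing Implicit Defensive.
Import Order.TTheory GRing.Theory Num.Theory.
Local Open Scope ring_scope.
Local Open Scope quotient_scope.

(** * Expansions of rational functions *)


(** The identity h Q = P of formal power series, read coefficient by coefficient. *)
Definition is_expansion (h : nat -> int) (P Q : {poly int}) :=
  forall k, \sum_(i < k.+1) h i * Q`_(k - i) = P`_k.

Lemma coefM_eq (P P' R : {poly int}) k :
  (forall j, (j <= k)%N -> P`_j = P'`_j) -> (P * R)`_k = (P' * R)`_k.
Proof.
move=> PP'; rewrite !coefM; apply: eq_bigr => i _.
by rewrite PP' // -ltnS.
Qed.

(** Up to degree [k] a polynomial truncation replaces the series [h], so that ring identities in
    [{poly int}] apply. *)
Lemma expansion_trunc h (P Q : {poly int}) k j : is_expansion h P Q -> (j <= k)%N ->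
  ((\poly_(i < k.+1) h i) * Q)`_j = P`_j.
Proof.
move=> hPQ jk; rewrite -hPQ coefM; apply: eq_bigr => i _.
by rewrite coef_poly ltnS (leq_trans _ jk) // -ltnS.
Qed.

Lemma expansion_expand (P Q : {poly int}) : Q`_0 = 1 -> is_expansion (expand P Q) P Q.
Proof. by move=> Q0 k; rewrite expandP // Q0. Qed.

Lemma expansion_uniq h (P Q : {poly int}) k : Q`_0 = 1 -> is_expansion h P Q -> expand P Q k = h k.
Proof.
move=> Q0 hPQ; have [m] := ubnP k; elim: m k => // m IH k.
rewrite ltnS => km.
have := expansion_expand P Q0 k; rewrite -hPQ !big_ord_recr /= subnn Q0 !mulr1.
rewrite (eq_bigr (fun i : 'I_k => h i * Q`_(k - i))); first by move/addrI.
by move=> i _; rewrite IH // (leq_trans (ltn_ord i)).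
Qed.

Lemma expansion_mull h P Q R : is_expansion h P Q -> is_expansion h (P * R) (Q * R).
Proof.
move=> hPQ k; transitivity (((\poly_(i < k.+1) h i) * (Q * R))`_k).
  by rewrite coefM; apply: eq_bigr => i _; rewrite coef_poly ltn_ord.
by rewrite mulrA; apply: coefM_eq => j jk; exact: expansion_trunc.
Qed.

Lemma expansion_lin c h h' P P' Q : is_expansion h P Q -> is_expansion h' P' Q ->
  is_expansion (fun k => c * h k + h' k) (c *: P + P') Q.
Proof.
move=> hP hP' k; rewrite coefD coefZ -hP -hP' mulr_sumr -big_split /=.
by apply: eq_bigr => i _; rewrite mulrDl mulrA.
Qed.

(** Taking partial sums divides the generating function by 1 - t. *)
Lemma expansion_sum h f P Q : is_expansion h P Q -> f 0%N = h 0%N ->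
    (forall k, f k.+1 = f k + h k.+1) ->
  is_expansion f P (Q * (1 - 'X)).
Proof.
move=> hPQ f0 fS k.
transitivity ((((\poly_(i < k.+1) f i) * (1 - 'X)) * Q)`_k).
  rewrite -mulrA [_ * Q]mulrC coefM.
  by apply: eq_bigr => i _; rewrite coef_poly ltn_ord.
rewrite -(expansion_trunc hPQ (leqnn k)); apply: coefM_eq => -[|j] jk.
  by rewrite mulrBr mulr1 coefB coefMX !coef_poly /= subr0.
rewrite mulrBr mulr1 coefB coefMX !coef_poly !ltnS jk /= ltnW //.
by rewrite fS addrC addKr.
Qed.

(** A polynomial [G] that is right only up to degree [k] suffices; this fits generating functions of
    labels bounded by [k]. *)
Lemma expansion_of_poly (G P Q : {poly int}) k : Q`_0 = 1 ->
  (forall j, (j <= k)%N -> (G * Q)`_j = P`_j) -> expand P Q k = G`_k.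
Proof.
move=> Q0 GQ; suff H m : (m <= k)%N -> expand P Q m = G`_m by exact: H.
have [M] := ubnP m; elim: M m => // M IH m; rewrite ltnS => mM mk.
have := GQ m mk; rewrite coefM -(expansion_expand P Q0 m) !big_ord_recr /= subnn Q0.
rewrite !mulr1 (eq_bigr (fun i : 'I_m => expand P Q i * Q`_(m - i))) //.
  by move/addrI.
by move=> i _; rewrite IH // ?(leq_trans (ltn_ord i)) // ltnW ?(leq_trans (ltn_ord i)).
Qed.

Lemma coef0_1subX d : (((1 - 'X) : {poly int}) ^+ d)`_0 = 1.
Proof.
by rewrite -horner_coef0 horner_exp !hornerE expr1n.
Qed.

(** Induction on [m]: each factor 1/(1-t) takes partial sums, and Pascal's rule evaluates them. *)
Lemma expand_Xn a m k :
  expand 'X^a ((1 - 'X) ^+ m.+1) k =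
    if (a <= k)%N then ('C(k - a + m, m))%:Z else 0.
Proof.
rewrite (@expansion_uniq
  (fun k => if (a <= k)%N then ('C(k - a + m, m))%:Z else 0)) //.
  exact: coef0_1subX.
have g0 : is_expansion (fun k => (k == a)%:R) 'X^a 1.
  move=> j; rewrite big_ord_recr /= subnn coef1 mulr1 coefXn.
  rewrite big1 ?add0r // => i _.
  by rewrite coef1 subn_eq0 leqNgt ltn_ord mulr0.
elim: m => [|m IH].
  rewrite expr1 -[1 - 'X]mul1r; apply: expansion_sum g0 _ _ => [|j] /=.
    by case: a => //= a; rewrite addn0 bin0.
  rewrite !addn0 !bin0 (leq_eqVlt a j.+1) ltnS eq_sym.
  case: eqP => [<-|_] /=; first by rewrite ltnn add0r.
  by rewrite addr0.
rewrite exprSr; apply: expansion_sum IH _ _ => [|j].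
  by rewrite leqn0; case: eqP => // ->; rewrite subn0 !add0n !binn.
rewrite (leq_eqVlt a j.+1) ltnS.
case: eqP => [->|_] /=; first by rewrite ltnn subnn !add0n !binn.
case: ifP => // aj; rewrite -PoszD; congr Posz.
by rewrite subSn // !addSn binS addnS.
Qed.

Lemma expand_psum P d k :
  \sum_(j < k.+1) expand P ((1 - 'X) ^+ d) j = expand P ((1 - 'X) ^+ d.+1) k.
Proof.
rewrite (@expansion_uniq (fun k => \sum_(j < k.+1) expand P ((1 - 'X) ^+ d) j)) //.
  exact: coef0_1subX.
rewrite exprSr; apply: expansion_sum (expansion_expand P (coef0_1subX d)) _ _ => [|j].
  by rewrite big_ord1.
by rewrite big_ord_recr.
Qed.

(** The partial sums of |P_j| are bounded by [B], and each further factor 1/(1-t) adds up at most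
    k+1 terms. *)
Lemma expand_bound P d : exists A : nat,
  forall k, expand P ((1 - 'X) ^+ d.+1) k <= (A * k.+1 ^ d)%:Z.
Proof.
pose B := (\sum_(i < size P) absz (P`_i)%R)%N.
have PB k : (\sum_(j < k.+1) absz (P`_j)%R <= B)%N.
  rewrite (big_ord_widen _ (fun j => absz (P`_j)%R) (leq_addl (size P) k.+1)).
  rewrite /B (big_ord_widen _ (fun j => absz (P`_j)%R) (leq_addr k.+1 (size P))).
  rewrite [leqLHS]big_mkcond [leqRHS]big_mkcond; apply: leq_sum => i _.
  by case: (ltnP i (size P)) => iP; case: ifP => //; rewrite nth_default.
exists B; elim: d => [|d IH] k.
  rewrite -expand_psum expn0 muln1.
  apply: (@le_trans _ _ (\sum_(j < k.+1) absz (P`_j)%R)%:Z); last by rewrite lez_nat.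
  rewrite -[leRHS]natz natr_sum; apply: ler_sum => j _.
  rewrite expr0 (@expansion_uniq (fun i => P`_i)) ?coef1 ?natz ?abszE ?ler_norm //.
  move=> i; rewrite big_ord_recr /= subnn coef1 mulr1 big1 ?add0r // => l _.
  by rewrite coef1 subn_eq0 leqNgt ltn_ord mulr0.
rewrite -expand_psum; apply: (@le_trans _ _
    (\sum_(j < k.+1) (B * k.+1 ^ d)%N%:Z)).
  apply: ler_sum => j _; apply: le_trans (IH j) _.
  rewrite lez_nat leq_mul2l; case: d {IH} => [|d]; first by rewrite orbT.
  by rewrite leq_exp2r ?ltn_ord ?orbT.
rewrite sumr_const card_ord -mulr_natr natz -PoszM lez_nat expnSr mulnA.
exact: leqnn.
Qed.

(** * Counting by generating functions *)


(** Expanding the product by distributivity, each [f] contributes t to the power of its total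
    weight. *)
Lemma card_weight (I L : finType) (P : I -> pred L) (w : L -> nat) k :
  (#|[set f : {ffun I -> L} |
       [forall i, P i (f i)] && (\sum_i w (f i) == k)%N]|)%:Z =
  (\prod_i \sum_(l | P i l) 'X^(w l) : {poly int})`_k.
Proof.
rewrite bigA_distr_big_dep coef_sum -sum1_card -[LHS]natz natr_sum.
rewrite (eq_bigl _ _ (fun f => in_set _ f)) big_mkcondr /=.
under [RHS]eq_bigr do rewrite -expr_sum coefXn.
apply: eq_big => [f|f _]; last by rewrite eq_sym; case: eqP.
by apply/forallP/familyP => Pf i; exact: Pf.
Qed.

Lemma coef_prod_eq (I : finType) (F G : I -> {poly int}) k :
  (forall i j, (j <= k)%N -> (F i)`_j = (G i)`_j) ->
  forall j, (j <= k)%N -> (\prod_i F i)`_j = (\prod_i G i)`_j.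
Proof.
move=> FG; apply: (big_ind2 (fun A B : {poly int} =>
  forall j, (j <= k)%N -> A`_j = B`_j)) => [//|A A' B B' AA' BB' j jk|i _].
  rewrite (@coefM_eq _ A') => [|i ij]; last exact: AA' (leq_trans ij jk).
  rewrite ![A' * _]mulrC; apply: coefM_eq => i ij; exact: BB' (leq_trans ij jk).
exact: FG.
Qed.

Lemma expand_prod (I : finType) (F G : I -> {poly int}) k :
    (forall i j, (j <= k)%N -> (F i * (1 - 'X))`_j = (G i)`_j) ->
  (\prod_i F i)`_k = expand (\prod_i G i) ((1 - 'X) ^+ #|I|) k.
Proof.
move=> FG; apply/esym/expansion_of_poly => [|j jk]; first exact: coef0_1subX.
by rewrite -prodr_const -big_split /=; apply: coef_prod_eq jk.
Qed.

Lemma sum_Xn_mul k : (\sum_(i < k.+1) 'X^i : {poly int}) * (1 - 'X) = 1 - 'X^(k.+1).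
Proof. by rewrite -(opprB 'X^_) subrX1 -mulNr opprB mulrC. Qed.

Lemma sum_Xn_gt0_mul k :
  (\sum_(i < k.+1 | (0 < i)%N) 'X^i : {poly int}) * (1 - 'X) = 'X - 'X^(k.+1).
Proof.
have := sum_Xn_mul k; rewrite (bigD1 ord0) //= expr0 mulrDl mul1r.
rewrite (eq_bigl (fun i : 'I_k.+1 => 0 < i)%N) => [|i]; last by rewrite lt0n.
by move/eqP; rewrite addrC eq_sym -subr_eq => /eqP <-; ring.
Qed.

Section Counts.
Variables (p k : nat).

Definition zero_or_zero (l : 'I_k.+1 * 'I_k.+1) := (l.1 == ord0) || (l.2 == ord0).

(** Exponents of x_i and y_(i+1), for each [i], in a hub-free monomial without a factor x_i y_(i+1).
    In total degree [k] no exponent exceeds [k], so the range ['I_k.+1] loses nothing. *)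
Definition pair_labels := [set f : {ffun 'I_p -> 'I_k.+1 * 'I_k.+1} |
  [forall i, zero_or_zero (f i)] && (\sum_i ((f i).1 + (f i).2) == k)%N].

Definition full_labels := [set f : {ffun 'I_p -> 'I_k.+1} |
  [forall i, 0 < f i]%N && (\sum_i f i == k)%N].

(** Vertex degrees when the hub [h] occurs; here the [p] vertices include the hub. *)
Definition pos_labels (h : 'I_p) := [set f : {ffun 'I_p -> 'I_k.+1} |
  (0 < f h)%N && (\sum_i f i == k)%N].

Lemma card_pair_labels :
  (#|pair_labels|)%:Z = expand ((1 + 'X) ^+ p) ((1 - 'X) ^+ p) k.
Proof.
rewrite (card_weight (fun _ => zero_or_zero) (fun l => l.1 + l.2)%N).
rewrite (@expand_prod _ _ (fun => 1 + 'X)) ?prodr_const ?card_ord // => _ j jk.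
(* Split by whether the first exponent vanishes: the factor is (1 + ... + t^k) + (t + ... + t^k),
   and its product with 1 - t agrees with 1 + t up to degree [k]. *)
rewrite (bigID (fun l : 'I_k.+1 * 'I_k.+1 => l.1 == ord0)) /=.
have -> : (\sum_(l : 'I_k.+1 * 'I_k.+1 | zero_or_zero l && (l.1 == ord0))
            'X^(l.1 + l.2) : {poly int}) = \sum_(i < k.+1) 'X^i.
  rewrite (eq_bigl (fun l : 'I_k.+1 * 'I_k.+1 => (l.1 == ord0) && true)).
    by rewrite -(pair_big_dep (pred1 ord0) (fun _ => xpredT) (fun i j : 'I_k.+1 => 'X^(i + j)))
      big_pred1_eq.
  by move=> l; rewrite /zero_or_zero; case: eqP; rewrite ?andbF.
have -> : (\sum_(l : 'I_k.+1 * 'I_k.+1 | zero_or_zero l && (l.1 != ord0))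
            'X^(l.1 + l.2) : {poly int}) = \sum_(i < k.+1 | (0 < i)%N) 'X^i.
  rewrite (eq_bigl (fun l : 'I_k.+1 * 'I_k.+1 => (0 < l.1)%N && (l.2 == ord0))).
    rewrite -(pair_big_dep (fun i : 'I_k.+1 => 0 < i)%N (fun _ => pred1 ord0)
      (fun i j : 'I_k.+1 => 'X^(i + j))) /=.
    by apply: eq_bigr => i _; rewrite big_pred1_eq addn0.
  move=> l; rewrite /zero_or_zero lt0n.
  by rewrite -[l.1 == ord0]/(val l.1 == 0)%N; case: eqP => /=; rewrite ?andbF ?andbT.
rewrite mulrDl sum_Xn_mul sum_Xn_gt0_mul.
by rewrite !(coefD, coefN, coefXn) eqn_leq [(k < j)%N]ltnNge jk andbF !subr0.
Qed.

Lemma card_full_labels : (#|full_labels|)%:Z = expand 'X^p ((1 - 'X) ^+ p) k.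
Proof.
rewrite (card_weight (fun _ (l : 'I_k.+1) => 0 < l)%N (fun l => l : nat)).
rewrite (@expand_prod _ _ (fun => 'X)) ?prodr_const ?card_ord // => _ j jk.
by rewrite sum_Xn_gt0_mul coefB coefXn eqn_leq [(k < j)%N]ltnNge jk andbF subr0.
Qed.

Lemma card_pos_labels h : (#|pos_labels h|)%:Z = expand 'X ((1 - 'X) ^+ p) k.
Proof.
(* Positivity at [h] becomes a condition at every vertex, trivial away from [h], as [card_weight]
   expects. *)
transitivity ((#|[set f : {ffun 'I_p -> 'I_k.+1} |
    [forall i, (i == h) ==> (0 < f i)%N] && (\sum_i f i == k)%N]|)%:Z : int).
  congr Posz; apply: eq_card => f; rewrite !inE; congr andb.
  apply/idP/forallP => [fh i|/(_ h)]; last by rewrite eqxx.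
  by apply/implyP => /eqP->.
rewrite (card_weight (fun i (l : 'I_k.+1) => (i == h) ==> (0 < l)%N)
  (fun l => l : nat)).
rewrite (@expand_prod _ _ (fun i => if i == h then 'X else 1)) => [|i j jk].
  by rewrite card_ord -big_mkcond big_pred1_eq.
case: eqP => _ /=; rewrite ?sum_Xn_gt0_mul ?sum_Xn_mul.
  by rewrite coefB coefXn eqn_leq [(k < j)%N]ltnNge jk andbF subr0.
by rewrite coefB coefXn eqn_leq [(k < j)%N]ltnNge jk andbF subr0.
Qed.

End Counts.

(** * Linearity of expansions and the three summands of the wheel series *)

Lemma expandD P P' d k : expand (P + P') ((1 - 'X) ^+ d) k =
  expand P ((1 - 'X) ^+ d) k + expand P' ((1 - 'X) ^+ d) k.
Proof.
have gE Q := expansion_expand Q (coef0_1subX d).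
have := expansion_uniq k (coef0_1subX d) (expansion_lin 1 (gE P) (gE P')).
by rewrite scale1r mul1r.
Qed.

Lemma expandZ c P d k : expand (c *: P) ((1 - 'X) ^+ d) k =
  c * expand P ((1 - 'X) ^+ d) k.
Proof.
have g0 : is_expansion (fun=> 0) 0 ((1 - 'X) ^+ d).
  by move=> j; rewrite coef0 big1 // => i _; rewrite mul0r.
have := expansion_uniq k (coef0_1subX d) (expansion_lin c (expansion_expand P (coef0_1subX d)) g0).
by rewrite !addr0.
Qed.

Lemma expand_mul1subX P d k :
  expand (P * (1 - 'X)) ((1 - 'X) ^+ d.+1) k = expand P ((1 - 'X) ^+ d) k.
Proof.
apply: expansion_uniq; first exact: coef0_1subX.
by rewrite exprSr; apply: expansion_mull (expansion_expand P (coef0_1subX d)).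
Qed.

Section WheelNumbers.
Variable p : nat.
Hypothesis p_gt0 : (0 < p)%N.

Let N1 : {poly int} :=
  (1 - 'X^2) * (1 + 'X) ^+ (p - 1) + (p - 1)%:R *: 'X^p + 'X^(p + 1).
Let N2 : {poly int} := (p - 1)%:R *: 'X^2 + 2%:R *: 'X.

(** Multiplying the k-th coefficient of F by k+1 gives the series (tF)'; here F = t/(1-t)^(p+1). *)
Lemma expand_hub k :
  expand N2 ((1 - 'X) ^+ (p + 2)) k =
    k.+1%:Z * expand 'X ((1 - 'X) ^+ (p + 1)) k.
Proof.
rewrite expandD !expandZ addn2 addn1.
rewrite [expand 'X _ _](expand_Xn 1) [expand 'X _ _](expand_Xn 1) expand_Xn.
case: k => [|[|k]] /=; first by rewrite !mulr0.
  by rewrite mulr0 subnn !add0n !binn add0r mulr1.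
rewrite !subSS !subn0 !natz !addSn !addnS.
have nk : ((k + p).+1 - p = k.+1)%N by lia.
(* By Pascal's rule only b = C(n,p+1) and a = C(n,p) remain, with n = k+p+1; they satisfy (p+1) b =
   (k+1) a. *)
have := mul_bin_left (k + p).+1 p; rewrite {}nk.
move: (k + p).+1 => n; rewrite binS.
move: ('C(_, p.+1)) ('C(_, p)) => b a /(congr1 Posz); rewrite !PoszM !PoszD => E.
have -> : (p - 1)%N%:Z = p%:Z - 1 by lia.
lia.
Qed.

(** Multiplying the k-th coefficient of F by k-1 gives tF' - F; here F = t^p/(1-t)^p. The truncated
    predecessor is harmless at k = 0, where F has coefficient 0 because p > 0. *)
Lemma expand_full k :
  expand ((p - 1)%:R *: 'X^p + 'X^(p + 1)) ((1 - 'X) ^+ (p + 1)) k =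
    k.-1%:Z * expand 'X^p ((1 - 'X) ^+ p) k.
Proof.
rewrite expandD !expandZ addn1.
case: p p_gt0 => // q _; rewrite !expand_Xn subn1 /=.
case: k => [|k]; first by rewrite !mulr0.
rewrite !ltnS !subSS /= natz.
case: ltngtP => qk; rewrite ?mulr0 //; last first.
  by rewrite qk subnn !add0n !binn addr0.
rewrite subnK // addnS !subnK ?(ltnW qk) // binS.
have /(congr1 Posz) := mul_bin_left k q; rewrite !PoszM PoszD.
have -> : (k - q)%N%:Z = k%:Z - q%:Z by lia.
move: ('C(_, q.+1)) ('C(_, q)) => b a E; lia.
Qed.

Lemma expand_wheel k (h : 'I_(p + 1)) :
  (#|pair_labels p k| + #|full_labels p k| * k.-1 + #|pos_labels k h| * k.+1)%N%:Z =
  expand N1 ((1 - 'X) ^+ (p + 1)) k + expand N2 ((1 - 'X) ^+ (p + 2)) k.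
Proof.
rewrite !PoszD !PoszM card_pair_labels card_full_labels card_pos_labels.
have -> : N1 = (1 - 'X^2) * (1 + 'X) ^+ (p - 1)
  + ((p - 1)%:R *: 'X^p + 'X^(p + 1)) by rewrite addrA.
rewrite expand_hub expandD expand_full.
rewrite ![_ * Posz _]mulrC; congr (_ + _ + _).
(* The identity (1+t)^p (1-t) = (1-t^2)(1+t)^(p-1) brings the first summand to the denominator
   (1-t)^(p+1). *)
rewrite addn1 -(expand_mul1subX ((1 + 'X) ^+ p)); congr (expand _ _ k).
by case: p p_gt0 => // q _; rewrite subn1 exprSr; ring.
Qed.

Lemma expand_wheel_merge k :
  expand N1 ((1 - 'X) ^+ (p + 1)) k + expand N2 ((1 - 'X) ^+ (p + 2)) k =
  expand (N1 * (1 - 'X) + N2) ((1 - 'X) ^+ (p + 2)) k.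
Proof. by rewrite [RHS]expandD addn1 addn2 expand_mul1subX. Qed.

Lemma wheel_multiplicity : (N1 * (1 - 'X) + N2).[1] = (p + 1)%:Z.
Proof.
rewrite /N2 !hornerE /=.
lia.
Qed.
End WheelNumbers.

(** * Classes of monomials modulo a binomial edge ideal *)


Section Classes.
Variables (K : fieldType) (n : nat) (e : rel 'I_n).
Hypothesis e_sym : ssrbool.symmetric e.

Local Notation S := {mpoly K[n + n]}.
Local Notation mon := 'X_{1..n + n}.
Local Notation J := (@bei K n e).

Definition xdeg (m : mon) (i : 'I_n) := m (lshift n i).
Definition ydeg (m : mon) (i : 'I_n) := m (rshift n i).
Definition vdeg (m : mon) := [ffun i => xdeg m i + ydeg m i]%N.

Definition xmon (i : 'I_n) : mon := U_(lshift n i)%MM.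
Definition ymon (i : 'I_n) : mon := U_(rshift n i)%MM.

Lemma xdegD m m' i : xdeg (m + m')%MM i = (xdeg m i + xdeg m' i)%N.
Proof. exact: mnmDE. Qed.
Lemma ydegD m m' i : ydeg (m + m')%MM i = (ydeg m i + ydeg m' i)%N.
Proof. exact: mnmDE. Qed.
Lemma xdeg_xmon j i : xdeg (xmon j) i = (j == i).
Proof. by rewrite /xdeg mnm1E eq_lshift. Qed.
Lemma xdeg_ymon j i : xdeg (ymon j) i = 0%N.
Proof. by rewrite /xdeg mnm1E eq_rlshift. Qed.
Lemma ydeg_xmon j i : ydeg (xmon j) i = 0%N.
Proof. by rewrite /ydeg mnm1E eq_lrshift. Qed.
Lemma ydeg_ymon j i : ydeg (ymon j) i = (j == i).
Proof. by rewrite /ydeg mnm1E eq_rshift. Qed.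
Definition degE := (xdegD, ydegD, xdeg_xmon, xdeg_ymon, ydeg_xmon, ydeg_ymon).

Lemma mon_eq m m' : xdeg m =1 xdeg m' -> ydeg m =1 ydeg m' -> m = m'.
Proof.
move=> xE yE; apply/mnmP => i; rewrite -(splitK i).
by case: (split i) => j /=; [exact: xE | exact: yE].
Qed.

Lemma mdeg_vdeg m : mdeg m = (\sum_i vdeg m i)%N.
Proof.
rewrite mdegE big_split_ord /= -big_split /=.
by apply: eq_bigr => i _; rewrite ffunE.
Qed.

Lemma xmonK m i : (0 < xdeg m i)%N -> (m - xmon i + xmon i)%MM = m.
Proof. by move=> mi; rewrite submK // lep1mP -lt0n. Qed.

Lemma ymonK m i : (0 < ydeg m i)%N -> (m - ymon i + ymon i)%MM = m.
Proof. by move=> mi; rewrite submK // lep1mP -lt0n. Qed.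

Definition binom (i j : 'I_n) : S :=
  xvar K i * yvar K j - xvar K j * yvar K i.

Lemma binomE i j : binom i j = 'X_[xmon i + ymon j] - 'X_[xmon j + ymon i].
Proof. by rewrite !mpolyXD. Qed.

Lemma bei_edge i j : e i j -> binom i j \in J.
Proof.
(* The generators are indexed by pairs i < j; symmetry of [e] and a change of sign give the other
   order. *)
have edge_lt (i' j' : 'I_n) : (i' < j')%N -> e i' j' -> binom i' j' \in J.
  move=> ij eij; apply/beiP.
  exists (fun a b => ((a == i') && (b == j'))%:R).
  rewrite (bigD1 i') //= (bigD1 j') /= ?eij // !eqxx mul1r.
  rewrite !big1 ?addr0 // => [a ai|b /andP[_ bj]].
    by rewrite big1 // => b _; rewrite (negPf ai) mul0r.
  by rewrite (negPf bj) mul0r.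
case: (ltngtP i j) => [ij|ij|/val_inj->] eij.
- exact: edge_lt.
- rewrite /binom -opprB rpredN.
  by apply: edge_lt => //; rewrite e_sym.
- by rewrite /binom subrr rpred0.
Qed.

(** Induction along the path by x_l b(i,j) = x_i b(l,j) + x_j b(i,l), and the same with y, where b
    is [binom]: the variable at the first inner vertex [l] is traded for one at [i] or [j]. *)
Lemma binom_path q w i j : path e i (rcons q j) -> uniq q ->
  (forall l, l \in q -> 0 < vdeg w l)%N -> 'X_[w] * binom i j \in J.
Proof.
elim: q w i => [|l q IH] w i /=.
  by case/andP=> eij _ _ _; apply/idealMr/bei_edge.
case/andP=> eil lq /andP[l_q q_uniq] wq.
have wq' w' z : w = (w' + z l)%MM -> z = xmon \/ z = ymon ->
    forall l', l' \in q -> (0 < vdeg (w' + z i)%MM l')%N.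
  move=> ww zE l' l'q; have: (0 < vdeg w l')%N by apply: wq; rewrite inE l'q orbT.
  have ll' : l != l' by apply: contraNneq l_q => ->.
  by case: zE ww => -> ->; rewrite !ffunE !degE (negPf ll'); lia.
have : (0 < vdeg w l)%N by apply: wq; rewrite mem_head.
rewrite ffunE addn_gt0 => /orP[] /[dup] wl.
  move/xmonK; move: (_ - _)%MM => w' /esym ww'.
  have -> : 'X_[w] * binom i j =
      'X_[w' + xmon i] * binom l j + 'X_[w' + xmon j] * binom i l.
    by rewrite ww' !mpolyXD /binom /xvar /yvar; ring.
  apply: rpredD; last exact/idealMr/bei_edge.
  by apply: IH => //; apply: (wq' _ xmon) => //; left.
move/ymonK; move: (_ - _)%MM => w' /esym ww'.
have -> : 'X_[w] * binom i j =
    'X_[w' + ymon i] * binom l j + 'X_[w' + ymon j] * binom i l.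
  by rewrite ww' !mpolyXD /binom /xvar /yvar; ring.
apply: rpredD; last exact/idealMr/bei_edge.
by apply: IH => //; apply: (wq' _ ymon) => //; right.
Qed.

Definition supp_rel (s : {ffun 'I_n -> nat}) : rel 'I_n :=
  fun i j => [&& e i j, 0 < s i & 0 < s j]%N.

(** These are the unions of connected components of the induced graph, up to vertices outside the
    support, whose x-degree is zero. *)
Definition supp_closed (s : {ffun 'I_n -> nat}) (I : {set 'I_n}) :=
  [forall i, forall j, supp_rel s i j ==> ((i \in I) == (j \in I))].

Lemma supp_closedP s (I : {set 'I_n}) :
  reflect (closed (supp_rel s) I) (supp_closed s I).
Proof.
apply: (iffP forallP) => [cI i j|cI i].
  by move: (cI i) => /forallP/(_ j)/implyP ij /ij/eqP.
by apply/forallP => j; apply/implyP => /cI ->.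
Qed.

Lemma supp_rel_sym s : ssrbool.symmetric (supp_rel s).
Proof. by move=> i j; rewrite /supp_rel e_sym [(_ < s j)%N && _]andbC. Qed.

(* Invariant of a monomial modulo the relations x_i y_j = x_j y_i: the degree
   at each vertex, and the x-degree of each union of connected components of
   the graph induced on the support. *)
Definition label (m : mon) : {ffun 'I_n -> nat} * {ffun {set 'I_n} -> nat} :=
  (vdeg m, [ffun I : {set 'I_n} =>
              if supp_closed (vdeg m) I then \sum_(i in I) xdeg m i else 0]%N).

Lemma label_vdeg m m' : label m = label m' -> vdeg m = vdeg m'.
Proof. by case. Qed.

Lemma label_xdeg m m' (I : {set 'I_n}) : label m = label m' ->
  supp_closed (vdeg m) I ->
  (\sum_(i in I) xdeg m i = \sum_(i in I) xdeg m' i)%N.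
Proof. by case=> mm' /ffunP/(_ I); rewrite !ffunE -mm' => + cI; rewrite cI. Qed.

Lemma labelP m m' : vdeg m = vdeg m' ->
  (forall I : {set 'I_n}, supp_closed (vdeg m) I ->
    \sum_(i in I) xdeg m i = \sum_(i in I) xdeg m' i)%N ->
  label m = label m'.
Proof.
move=> mm' xE; congr pair => //; apply/ffunP => I; rewrite !ffunE -mm'.
by case: ifP => // /xE.
Qed.

Lemma vdeg_swap w i j :
  vdeg (w + (xmon i + ymon j))%MM = vdeg (w + (xmon j + ymon i))%MM.
Proof. by apply/ffunP => l; rewrite !ffunE !degE; lia. Qed.

(** The swap moves one x from [i] to [j], and a closed set contains both or neither. *)
Lemma label_swap w i j :
  connect (supp_rel (vdeg (w + (xmon i + ymon j))%MM)) i j ->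
  label (w + (xmon i + ymon j))%MM = label (w + (xmon j + ymon i))%MM.
Proof.
move=> ij; apply: labelP => [|I /supp_closedP cI]; first exact: vdeg_swap.
under eq_bigr do rewrite !degE addn0; under [RHS]eq_bigr do rewrite !degE addn0.
rewrite !big_split /=; congr addn.
rewrite -!big_mkcondr /= !sum1_card.
have card_eq l : #|[pred i0 in I | l == i0]| = (l \in I).
  rewrite -sum1_card; case: (boolP (l \in I)) => lI.
    by rewrite (big_pred1 l) // => l'; rewrite !inE eq_sym; case: eqP => [->|]; rewrite ?andbF ?lI.
  rewrite big_pred0 // => l'; rewrite !inE; case: eqP => [<-|]; rewrite ?andbF //.
  by rewrite (negPf lI).
by rewrite !card_eq (closed_connect cI ij).
Qed.

(** On a duplicate-free path the inner vertices differ from [i] and [j], so their degree comes from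
    [w] and [binom_path] applies. *)
Lemma swap_bei w i j :
  connect (supp_rel (vdeg (w + (xmon i + ymon j))%MM)) i j ->
  'X_[w + (xmon i + ymon j)] - 'X_[w + (xmon j + ymon i)] \in J.
Proof.
move=> ij; rewrite !(mpolyXD _ w) -mulrBr -binomE.
case/connectP: ij => p0 /shortenP[p ip p_uniq _] jE.
case/lastP: p ip p_uniq jE => [_ _ ->|q j' ip]; first by rewrite /binom subrr mulr0 rpred0.
rewrite last_rcons cons_uniq rcons_uniq mem_rcons inE negb_or => /andP[].
case/andP=> ij' iq /andP[j'q q_uniq] jE; rewrite -{j'}jE in ip ij' j'q.
apply: (@binom_path q) => //.
  by apply: sub_path ip => a b /and3P[].
move=> l lq; have : (0 < vdeg (w + (xmon i + ymon j))%MM l)%N.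
  have := ip; rewrite -cats1 cat_path => /andP[+ _].
  case/splitPr: lq => q1 q2; rewrite cat_path /= => /andP[_ /andP[/and3P[] //]].
have il : i != l by apply: contraNneq iq => ->.
have jl : j != l by apply: contraNneq j'q => ->.
by rewrite !ffunE !degE (negPf il) (negPf jl) !addn0.
Qed.

(** Induction on the total x-excess of [m] over [m']: an x at a vertex [i] with excess is swapped
    with a y at a vertex [j] with deficit in the same component. *)
Lemma label_bei m m' : label m = label m' -> 'X_[m] - 'X_[m'] \in J.
Proof.
have [d] := ubnP (\sum_i (xdeg m i - xdeg m' i))%N.
elim: d m => // d IH m dm lmm'.
have vE := label_vdeg lmm'.
have yE i : (xdeg m i + ydeg m i = xdeg m' i + ydeg m' i)%N.
  by move/ffunP: vE => /(_ i); rewrite !ffunE.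
have closed_comp i : supp_closed (vdeg m) [set j | connect (supp_rel (vdeg m)) i j].
  apply/supp_closedP => a b ab; rewrite !inE.
  by apply: (connect_closed (sym_connect_sym (@supp_rel_sym _))).
(* If no vertex has excess, all x-degrees agree, because their sums over all vertices do. *)
case: (pickP (fun i => xdeg m' i < xdeg m i)%N) => [i mi|le_mm']; last first.
  suff -> : m = m' by rewrite subrr rpred0.
  have xE i : xdeg m i = xdeg m' i.
    have cT : supp_closed (vdeg m) setT.
      by apply/supp_closedP => a b _; rewrite !inE.
    have iT : i \in [set: 'I_n] by rewrite inE.
    have := label_xdeg lmm' cT; rewrite (bigD1 i) // [RHS](bigD1 i) //=.
    have le_i : (xdeg m i <= xdeg m' i)%N by rewrite leqNgt le_mm'.
    have : (\sum_(i0 in setT | i0 != i) xdeg m i0 <=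
        \sum_(i0 in setT | i0 != i) xdeg m' i0)%N.
      by apply: leq_sum => l _; rewrite leqNgt le_mm'.
    move: (\sum_(i0 in _ | _) xdeg m i0)%N (\sum_(i0 in _ | _) xdeg m' i0)%N.
    by move: le_i; lia.
  by apply: mon_eq => // i; have := yE i; rewrite xE => /addnI.
set C := [set j | connect (supp_rel (vdeg m)) i j].
(* The x-degrees of [m] and [m'] have the same sum over [C], so the excess at [i] forces a
   deficit. *)
have [j jC mj] : exists2 j, j \in C & (xdeg m j < xdeg m' j)%N.
  apply/exists_inP; apply: contraLR isT; rewrite negb_exists_in => /forall_inP ge_mm'.
  have := label_xdeg lmm' (closed_comp i); rewrite -/C.
  have iC : i \in C by rewrite inE connect0.
  rewrite (bigD1 i) // [RHS](bigD1 i) //=.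
  have : (\sum_(l in C | l != i) xdeg m' l <= \sum_(l in C | l != i) xdeg m l)%N.
    by apply: leq_sum => l /andP[lC _]; rewrite leqNgt ge_mm'.
  by move: mi; set A := (\sum_(l in C | _) xdeg m l)%N; set B := (\sum_(l in C | _) xdeg m' l)%N; lia.
have yj : (0 < ydeg m j)%N by have := yE j; lia.
have [w mE] : exists w, m = (w + (xmon i + ymon j))%MM.
  exists (m - xmon i - ymon j)%MM; rewrite [(xmon i + _)%MM]addmC addmA.
  rewrite ymonK ?xmonK // ?(leq_ltn_trans _ mi) //.
  by rewrite /ydeg mnmBE -/(ydeg m j) -/(ydeg (xmon i) j) degE subn0.
have ij : connect (supp_rel (vdeg (w + (xmon i + ymon j))%MM)) i j.
  by rewrite -mE; rewrite inE in jC.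
rewrite -(subrK 'X_[w + (xmon j + ymon i)] 'X_[m]) -addrA {1}mE.
apply: rpredD; first exact: swap_bei.
apply: IH; last by rewrite -(label_swap ij) -mE.
rewrite -ltnS; apply: leq_trans dm; rewrite ltnS.
have i_j : i != j by apply: contraTneq mi => ->; rewrite -leqNgt ltnW.
rewrite (bigD1 i) // [ltnRHS](bigD1 i) //=.
rewrite -addSn leq_add //.
  by rewrite mE !degE eqxx eq_sym (negPf i_j) /= in mi *; lia.
have wj : (xdeg w j < xdeg m' j)%N.
  by move: mj; rewrite mE !degE (negPf i_j) !addn0.
apply: leq_sum => l li; rewrite mE !degE [i == l]eq_sym (negPf li).
by case: eqP => [<-|_] /=; move: wj; lia.
Qed.
End Classes.

(** * The class basis of the quotient *)


Section Basis.
Variables (K : fieldType) (n : nat) (e : rel 'I_n).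
Hypothesis e_sym : ssrbool.symmetric e.

Local Notation S := {mpoly K[n + n]}.
Local Notation mon := 'X_{1..n + n}.
Local Notation J := (@bei K n e).
Local Notation Q := {ideal_quot (@bei K n e : idealr S)}.

Lemma pi_eqP (f g : S) : reflect (\pi_Q f = \pi_Q g) (f - g \in J).
Proof. by rewrite Quotient.idealrBE; apply: eqP. Qed.

Lemma pi_eq0 (f : S) : (\pi_Q f == 0) = (f \in J).
Proof. by rewrite -(rmorph0 \pi_Q) -Quotient.idealrBE subr0. Qed.

(** Linear functionals dual to the classes of degree [k]. The bound [k.+1] makes the index type
    finite. *)
Definition class_coef k t (f : S) : K :=
  \sum_(m : bmultinom (n + n) k.+1 | (mdeg m == k) && (label e m == t)) f@_m.

Fact class_coef_is_linear k t : linear_for *%R (class_coef k t).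
Proof.
move=> c f g; rewrite /class_coef mulr_sumr -big_split /=.
by apply: eq_bigr => m _; rewrite mcoeffD mcoeffZ.
Qed.
HB.instance Definition _ k t :=
  GRing.isLinear.Build K S K *%R (class_coef k t) (class_coef_is_linear k t).

Lemma class_coefX k t m :
  class_coef k t 'X_[m] = ((mdeg m == k) && (label e m == t))%:R.
Proof.
rewrite /class_coef; case: (ltnP (mdeg m) k.+1) => mk; last first.
  rewrite big1 => [|m' _]; last first.
    rewrite mcoeffX; case: eqP => // mm'.
    by have := bmdeg m'; rewrite -mm' ltnNge mk.
  by case: eqP => // mk'; rewrite mk' ltnn in mk.
pose b := BMultinom mk.
rewrite big_mkcond (bigD1 b) //= mcoeffX eqxx big1 ?addr0 => [|m' m'b].
  by case: ifP.
rewrite mcoeffX (_ : (m == m') = false) ?if_same //.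
by apply: contraNF m'b => /eqP mm'; apply/eqP/val_inj; rewrite /= mm'.
Qed.

(** J is spanned by monomial multiples of edge binomials, each a difference of two monomials of
    equal degree and label. *)
Lemma class_coef_bei k t f : f \in J -> class_coef k t f = 0.
Proof.
case/beiP=> a ->; rewrite raddf_sum big1 // => i _.
rewrite raddf_sum big1 // => j /andP[eij _] /=.
rewrite [a i j]mpolyE mulr_suml raddf_sum big1 // => w _.
rewrite -scalerAl /= scalarZ /= -/(binom K i j) binomE mulrBr -!mpolyXD.
rewrite raddfB /= !class_coefX (label_swap (i := i) (j := j)) //.
  by rewrite !mdegD !mdeg1 subrr mulr0.
by apply: connect1; rewrite /supp_rel eij !ffunE !degE !eqxx; lia.
Qed.

(** Independence comes from [class_coef], spanning from [label_bei]. *)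
Lemma has_dim_classes k (D : finType) (r : D -> mon) :
    (forall d, mdeg (r d) = k) ->
    (forall m, mdeg m = k -> exists d, label e m = label e (r d)) ->
    injective (fun d => label e (r d)) ->
  has_dim (@bei_quot_gr K n e k) #|D|.
Proof.
move=> rk r_surj r_inj; exists (fun i => \pi_Q 'X_[r (enum_val i)]); split.
  move=> c c0 i.
  have : \sum_i c i *: 'X_[r (enum_val i)] \in J.
    rewrite -pi_eq0 raddf_sum /=; apply/eqP; rewrite -[RHS]c0.
    by apply: eq_bigr => j _; rewrite pi_scale.
  move/(class_coef_bei k (label e (r (enum_val i)))).
  rewrite raddf_sum (bigD1 i) //= scalarZ /= class_coefX rk !eqxx mulr1.
  rewrite big1 ?addr0 // => j ji; rewrite scalarZ /= class_coefX.
  case: (label e _ =P _) => [/r_inj/enum_val_inj ji'|]; last by rewrite andbF mulr0.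
  by rewrite ji' eqxx in ji.
move=> u; split=> [[f fk ->]|[c ->]]; last first.
  exists (\sum_i c i *: 'X_[r (enum_val i)]).
    by apply: rpred_sum => i _; apply: rpredZ; rewrite -(rk (enum_val i)) dhomogX.
  by rewrite raddf_sum; apply: eq_bigr => i _; rewrite /= pi_scale.
rewrite [f]mpolyE raddf_sum /=.
elim/big_ind: _ => [|_ _ [c ->] [c' ->]|m _].
- by exists (fun=> 0); rewrite big1 // => i _; rewrite scale0r.
- exists (fun i => c i + c' i); rewrite -big_split /=.
  by apply: eq_bigr => i _; rewrite scalerDl.
- case: (boolP (m \in msupp f)) => [mf|/memN_msupp_eq0->]; last first.
    by exists (fun=> 0); rewrite scale0r rmorph0 big1 // => i _; rewrite scale0r.
  have [d md] := r_surj m (dhomog_mf fk mf).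
  exists (fun i => f@_m *+ (i == enum_rank d)).
  rewrite (bigD1 (enum_rank d)) //= eqxx enum_rankK big1 ?addr0.
    by rewrite pi_scale; congr (_ *: _); apply/pi_eqP/label_bei.
  by move=> i /negPf ->; rewrite scale0r.
Qed.
End Basis.

(** * Classes of monomials for the wheel *)


Lemma connect_fwd (T : finType) (r : rel T) (P : T -> Prop) x y :
  P x -> (forall a b, r a b -> P a -> P b) -> connect r x y -> P y.
Proof.
move=> Px Pr /connectP[q xq ->]; elim: q x Px xq => //= a q IH x Px /andP[xa aq].
by apply: IH aq; apply: Pr xa Px.
Qed.

Lemma connect_bwd (T : finType) (r : rel T) (P : T -> Prop) x y :
  P y -> (forall a b, r a b -> P b -> P a) -> connect r x y -> P x.
Proof.
move=> + Pr /connectP[q xq yE]; rewrite {}yE.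
by elim: q x xq => //= a q IH x /andP[xa aq] /(IH _ aq); apply: Pr xa.
Qed.

Lemma exists_partial_sum n (a : 'I_n -> nat) s : (s <= \sum_i a i)%N ->
  exists2 f : 'I_n -> nat, (forall i, f i <= a i)%N & (\sum_i f i = s)%N.
Proof.
elim: s => [_|s IH s_lt]; first by exists (fun=> 0%N) => //; rewrite big1.
have [f fa fs] := IH (ltnW s_lt).
case: (pickP (fun i => f i < a i)%N) => [i fi|af]; last first.
  suff : (\sum_i a i <= \sum_i f i)%N by rewrite fs leqNgt s_lt.
  by apply: leq_sum => i _; rewrite leqNgt af.
exists (fun j => f j + (j == i))%N => [j|].
  by case: eqP => [->|_]; rewrite ?addn1 // addn0.
rewrite big_split /= fs (bigD1 i) //= eqxx big1 => [|j /negPf-> //].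
by rewrite addn0 addn1.
Qed.

Definition mon_of n (a b : 'I_n -> nat) : 'X_{1..n + n} :=
  [multinom (match split i with inl j => a j | inr j => b j end) | i < n + n].

Lemma xdeg_mon_of n (a b : 'I_n -> nat) : xdeg (mon_of a b) =1 a.
Proof. by move=> i; rewrite /xdeg mnmE (unsplitK (inl i)). Qed.

Lemma ydeg_mon_of n (a b : 'I_n -> nat) : ydeg (mon_of a b) =1 b.
Proof. by move=> i; rewrite /ydeg mnmE (unsplitK (inr i)). Qed.

Lemma exists_mon n (v : 'I_n -> nat) s : (s <= \sum_i v i)%N ->
  exists2 m : 'X_{1..n + n}, vdeg m =1 v & (\sum_i xdeg m i = s)%N.
Proof.
case/exists_partial_sum=> f fv fs; exists (mon_of f (fun i => v i - f i)%N).
  by move=> i; rewrite ffunE xdeg_mon_of ydeg_mon_of subnKC.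
by under eq_bigr do rewrite xdeg_mon_of.
Qed.

Lemma label_sum n (e : rel 'I_n) (m m' : 'X_{1..n + n}) : label e m = label e m' ->
  (\sum_i xdeg m i = \sum_i xdeg m' i)%N.
Proof.
move=> lE; have cT : supp_closed e (vdeg m) setT.
  by apply/supp_closedP => a b _; rewrite !inE.
have := label_xdeg lE cT.
by rewrite !(eq_bigl _ _ (fun i => in_setT i)).
Qed.

Lemma vdeg_le n (m : 'X_{1..n + n}) i : (vdeg m i <= mdeg m)%N.
Proof. by rewrite mdeg_vdeg (bigD1 i) //= leq_addr. Qed.

Lemma xdeg_le n (m : 'X_{1..n + n}) i : (xdeg m i <= mdeg m)%N.
Proof. by apply: leq_trans (vdeg_le m i); rewrite ffunE leq_addr. Qed.

Lemma ydeg_le n (m : 'X_{1..n + n}) i : (ydeg m i <= mdeg m)%N.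
Proof. by apply: leq_trans (vdeg_le m i); rewrite ffunE leq_addl. Qed.

Lemma sum_xdeg_le n (m : 'X_{1..n + n}) : (\sum_i xdeg m i <= mdeg m)%N.
Proof. by rewrite mdeg_vdeg; apply: leq_sum => i _; rewrite ffunE leq_addr. Qed.

Section Wheel.
Variable p : nat.
Hypothesis p_gt0 : (0 < p)%N.

Local Notation e := (@wheel_graph p).
Local Notation mon := 'X_{1..(p + 1) + (p + 1)}.
Local Notation hub := (rshift p ord0 : 'I_(p + 1)).
Local Notation rim := (@lshift p 1).

Lemma wheelP (Q : 'I_(p + 1) -> Prop) :
  Q hub -> (forall i, Q (rim i)) -> forall i, Q i.
Proof.
move=> Qh Qr i; rewrite -(splitK i); case: (split i) => j; first exact: Qr.
by rewrite /= ord1.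
Qed.

Lemma wheel_rim i j : e (rim i) (rim j) = (j == ordS i) || (i == ordS j).
Proof.
by rewrite /wheel_graph /graph_join (unsplitK (inl i)) (unsplitK (inl j)).
Qed.

Lemma wheel_hub i : e hub (rim i).
Proof.
by rewrite /wheel_graph /graph_join (unsplitK (inr ord0)) (unsplitK (inl i)).
Qed.

Lemma sum_wheel (F : 'I_(p + 1) -> nat) :
  (\sum_i F i = \sum_(i < p) F (rim i) + F hub)%N.
Proof. by rewrite big_split_ord big_ord1. Qed.

Lemma rim_ind (P : 'I_p -> Prop) i :
  P i -> (forall j, P j -> P (ordS j)) -> forall j, P j.
Proof.
move=> Pi PS j; have PI t : P (iter t (@ordS p) i).
  by elim: t => //= t; apply: PS.
have iterE t : iter t (@ordS p) i = ((i + t) %% p)%N :> nat.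
  elim: t => [|t IH] /=; first by rewrite addn0 modn_small.
  by rewrite IH -addn1 modnDml addn1 addnS.
(* Cyclically, p - i + j successor steps lead from [i] to [j]. *)
have -> : j = iter (p - i + j)%N (@ordS p) i; last exact: PI.
apply: val_inj; rewrite /= iterE addnA subnKC 1?ltnW //.
by rewrite modnDl modn_small.
Qed.

(** Normal forms: by [std_label_inj] a class contains at most one such monomial. *)
Definition std (m : mon) := vdeg m hub = 0%N /\
  forall i, (xdeg m (rim i) = 0 \/ ydeg m (rim (ordS i)) = 0)%N.

Lemma sum_const_mem (I : {set 'I_(p + 1)}) (v f : 'I_(p + 1) -> nat) b :
  (forall i, f i <= v i)%N -> (forall i, 0 < v i -> (i \in I) = b)%N ->
  (\sum_(i in I) f i = if b then \sum_i f i else 0)%N.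
Proof.
move=> fv vI; rewrite big_mkcond /=; case: b vI => vI.
  apply: eq_bigr => i _; case: (posnP (v i)) => [v0|/vI->//].
  by have := fv i; rewrite v0 leqn0 => /eqP->; rewrite if_same.
rewrite big1 // => i _; case: (posnP (v i)) => [v0|/vI->//].
by have := fv i; rewrite v0 leqn0 => /eqP->; rewrite if_same.
Qed.

(** In both cases the support is connected, so a closed set contains all of it or none of it. *)
Lemma label_connected (m m' : mon) : vdeg m = vdeg m' ->
    (\sum_i xdeg m i = \sum_i xdeg m' i)%N ->
    (0 < vdeg m hub)%N \/ (forall i, 0 < vdeg m (rim i))%N ->
  label e m = label e m'.
Proof.
move=> vE xE conn; apply: labelP => // I /supp_closedP cI.
have [b bI] : exists b, forall i, (0 < vdeg m i)%N -> (i \in I) = b.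
  case: (posnP (vdeg m hub)) => [h0|h_gt0].
    have {}conn : forall i, (0 < vdeg m (rim i))%N by case: conn => //; rewrite h0.
    exists (rim (Ordinal p_gt0) \in I); apply: wheelP => [|i _]; first by rewrite h0.
    apply: (@rim_ind (fun i => (rim i \in I) = _) (Ordinal p_gt0)) => // j <-.
    by apply/esym/cI; rewrite /supp_rel wheel_rim eqxx !conn.
  exists (hub \in I); apply: wheelP => // i i_gt0.
  by apply/esym/cI; rewrite /supp_rel wheel_hub h_gt0.
rewrite (sum_const_mem (v := vdeg m) (b := b)) // => [|i]; last first.
  by rewrite ffunE leq_addr.
rewrite (sum_const_mem (v := vdeg m) (b := b)) ?xE // => i.
by rewrite vE ffunE leq_addr.
Qed.

(* If xdeg m' i < xdeg m i, then standardness makes m pure in x ahead of i and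
   m' pure in y behind i, as far as the support reaches; so xdeg m' <= xdeg m on
   the component of i, strictly at i, although the two sums agree. *)
Lemma std_label_le m m' : std m -> std m' -> label e m = label e m' ->
  forall i, (xdeg m (rim i) <= xdeg m' (rim i))%N.
Proof.
move=> [m_hub m_std] [_ m'_std] lE i; rewrite leqNgt; apply/negP => lt_i.
have vE (x : 'I_(p + 1)) : (xdeg m x + ydeg m x = xdeg m' x + ydeg m' x)%N.
  by have /ffunP/(_ x) := label_vdeg lE; rewrite !ffunE.
(* [I'] collects what is reached from [i] forwards or backwards within the support. It is closed
   since each rim vertex has one successor and one predecessor. *)
pose r : rel 'I_p := fun a b =>
  [&& b == ordS a, 0 < vdeg m (rim a) & 0 < vdeg m (rim b)]%N.
pose I' := [pred j | connect r i j || connect r j i].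
have I'_r a b : r a b -> (a \in I') = (b \in I').
  move=> ab; have /and3P[/eqP bE a_gt0 b_gt0] := ab; apply/idP/idP; rewrite !inE.
    case/orP=> [ia|].
      by rewrite (connect_trans ia (connect1 ab)).
    case/connectP=> -[|c q] /= => [_ ai|/andP[/and3P[/eqP cE _ _] cq] iE].
      by rewrite ai connect1.
    by apply/orP; right; apply/connectP; exists q; rewrite bE -cE.
  case/orP=> [|bi]; last by rewrite (connect_trans (connect1 ab) bi) orbT.
  case/connectP=> q; case/lastP: q => [_ /= <-|q c]; first by rewrite (connect1 ab) orbT.
  rewrite rcons_path last_rcons => /andP[iq /and3P[/eqP cE _ _]] bc.
  apply/orP; left; apply/connectP; exists q => //.
  by apply: (can_inj (@ordSK p)); rewrite -bE bc.
pose I := [set x : 'I_(p + 1) | if split x is inl j then j \in I' else false].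
have rimI j : (rim j \in I) = (j \in I') by rewrite inE (unsplitK (inl j)).
have cI : supp_closed e (vdeg m) I.
  apply/supp_closedP; apply: wheelP => [y|a]; first by rewrite /supp_rel m_hub andbF.
  apply: wheelP => [|b]; first by rewrite /supp_rel m_hub !andbF.
  rewrite /supp_rel wheel_rim !rimI => /and3P[/orP[]/eqP abE a_gt0 b_gt0].
    by apply: I'_r; rewrite /r abE eqxx -abE a_gt0.
  by apply/esym/I'_r; rewrite /r abE eqxx -abE a_gt0 b_gt0.
have le_fwd j : connect r i j -> (xdeg m' (rim j) <= xdeg m (rim j))%N.
  (* An x of [m] at one vertex excludes a y at the next, which then carries an x because it lies in
     the support. *)
  pose P j := (0 < xdeg m (rim j) /\ (j = i \/ ydeg m (rim j) = 0))%N.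
  move=> ij; suff [_ []] : P j by [move=> ->; apply: ltnW|have := vE (rim j); lia].
  apply: connect_fwd ij; first by split; [lia|left].
  move=> a b /and3P[/eqP-> _ b_gt0] [xa _].
  by case: (m_std a) => [|yb]; [lia|move: b_gt0; rewrite ffunE yb addn0; split; [|right]].
have le_bwd j : connect r j i -> (xdeg m' (rim j) <= xdeg m (rim j))%N.
  (* A y of [m'] at one vertex excludes an x at the previous one, which then carries a y. *)
  pose P j := (0 < ydeg m' (rim j) /\ (j = i \/ xdeg m' (rim j) = 0))%N.
  move=> ij; suff [_ []] : P j by [move=> ->; apply: ltnW|have := vE (rim j); lia].
  apply: connect_bwd ij; first by split; [have := vE (rim i); lia|left].
  move=> a b /and3P[/eqP-> a_gt0 _] [yb _].
  case: (m'_std a) => [xa|]; last by lia.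
  by move: a_gt0; rewrite ffunE vE xa add0n; split; [|right].
have le_I x : x \in I -> (xdeg m' x <= xdeg m x)%N.
  move: x; apply: wheelP => [|j]; first by rewrite inE (unsplitK (inr ord0)).
  by rewrite rimI => /orP[/le_fwd|/le_bwd].
have iI : rim i \in I by rewrite rimI inE connect0.
have := label_xdeg lE cI; rewrite (bigD1 (rim i)) // [RHS](bigD1 (rim i)) //=.
have : (\sum_(x in I | x != rim i) xdeg m' x <= \sum_(x in I | x != rim i) xdeg m x)%N.
  by apply: leq_sum => x /andP[/le_I].
by move: lt_i; set A := (\sum_(x in I | _) xdeg m x)%N; set B := (\sum_(x in I | _) xdeg m' x)%N; lia.
Qed.

Lemma std_label_inj m m' : std m -> std m' -> label e m = label e m' -> m = m'.
Proof.
move=> sm sm' lE.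
have vE (x : 'I_(p + 1)) : (xdeg m x + ydeg m x = xdeg m' x + ydeg m' x)%N.
  by have /ffunP/(_ x) := label_vdeg lE; rewrite !ffunE.
have xE : xdeg m =1 xdeg m'.
  apply: wheelP => [|i].
    by case: sm sm' => + _ [+ _]; rewrite !ffunE; lia.
  by apply/eqP; rewrite eqn_leq !std_label_le.
by apply: mon_eq => // x; have := vE x; rewrite xE => /addnI.
Qed.

(** An x at one rim vertex excludes a y at the next, which must then carry an x; so a single x
    spreads over the whole rim. *)
Lemma std_full (m : mon) : std m -> (forall i, 0 < vdeg m (rim i))%N ->
  (forall i, xdeg m (rim i) = 0)%N \/ (forall i, ydeg m (rim i) = 0)%N.
Proof.
move=> [_ m_std] m_gt0.
case: (pickP (fun i => 0 < xdeg m (rim i))%N) => [i xi|x0]; last first.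
  by left=> i; apply/eqP; rewrite -leqn0 leqNgt x0.
right; pose P i := (0 < xdeg m (rim i))%N.
have P_all : forall j, P j.
  apply: (rim_ind xi) => j Pj; case: (m_std j) => [x0|y0].
    by rewrite /P x0 in Pj.
  by have := m_gt0 (ordS j); rewrite ffunE y0 addn0.
move=> j; rewrite -(ord_predK j); case: (m_std (ord_pred j)) => // x0.
by have := P_all (ord_pred j); rewrite /P x0.
Qed.

(* Replacing x_i y_(i+1) by y_i x_(i+1) moves x's forward, and they cannot pass
   the vertex z, which is not in the support. *)
Lemma std_exists (m : mon) z : vdeg m hub = 0%N -> vdeg m (rim z) = 0%N ->
  exists2 m', std m' & label e m = label e m'.
Proof.
(* The number of steps forwards from [z] to [j]; it grows by one along the rim except on entering
   [z]. *)
pose pos (j : 'I_p) := ((j + (p - z)) %% p)%N.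
have posS j : ordS j != z -> pos (ordS j) = (pos j).+1.
  move=> jz; rewrite /pos /= modnDml addSn -addn1 -modnDml addn1 modn_small //.
  rewrite ltn_neqAle ltn_mod p_gt0 andbT; apply: contraNneq jz => posj.
  apply/eqP/val_inj => /=; have jp := ltn_ord j; have zp := ltn_ord z.
  move: posj; case: (leqP z j) => zj.
    have -> : (j + (p - z) = j - z + p)%N by lia.
    rewrite modnDr modn_small => [/eqP|]; last by lia.
    move=> jz; have -> : (j.+1 = p)%N by lia.
    by rewrite modnn; lia.
  rewrite modn_small => [/eqP jz|]; last by lia.
  by rewrite modn_small; lia.
(* Each move raises the position of one x by one, so this weighted sum decreases. *)
have [d] := ubnP (\sum_(j < p) (p - pos j) * xdeg m (rim j))%N.
elim: d m => // d IH m md m_hub m_z.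
case: (pickP (fun i => (0 < xdeg m (rim i)) && (0 < ydeg m (rim (ordS i))))%N)
  => [i /andP[xi yi]|m_std]; last first.
  exists m => //; split=> // i; have := m_std i.
  by case: (xdeg m (rim i)) => [|a]; [left|case: (ydeg _ _) => [|b]; [right|]].
have [w mE] : exists w, m = (w + (xmon (rim i) + ymon (rim (ordS i))))%MM.
  exists (m - xmon (rim i) - ymon (rim (ordS i)))%MM.
  rewrite [(xmon _ + _)%MM]addmC addmA ymonK ?xmonK //.
  by rewrite /ydeg mnmBE -/(ydeg m _) -/(ydeg (xmon _) _) degE subn0.
have lE : label e m = label e (w + (xmon (rim (ordS i)) + ymon (rim i)))%MM.
  rewrite mE; apply: label_swap; apply: connect1.
  by rewrite /supp_rel -mE wheel_rim eqxx !ffunE; lia.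
have [||| m' sm' lE'] := IH (w + (xmon (rim (ordS i)) + ymon (rim i)))%MM.
- rewrite -ltnS; apply: leq_trans md; rewrite ltnS mE.
  under eq_bigr do rewrite !degE addn0 mulnDr.
  under [ltnRHS]eq_bigr do rewrite !degE addn0 mulnDr.
  rewrite !big_split ltn_add2l /=.
  have sum_pt j : (\sum_(j' < p) (p - pos j') * (rim j == rim j') = p - pos j)%N.
    rewrite (bigD1 j) //= eqxx muln1 big1 ?addn0 // => j' jj'.
    by rewrite eq_lshift eq_sym (negPf jj') muln0.
  rewrite !sum_pt posS; first by have := ltn_pmod (i + (p - z)) p_gt0; rewrite -/(pos i); lia.
  (* [ordS i] is not [z], because a y occurs there while [z] is outside the support. *)
  by apply: contraTneq yi => ->; have := m_z; rewrite ffunE; lia.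
- by rewrite -(label_vdeg lE).
- by rewrite -(label_vdeg lE).
- by exists m' => //; rewrite lE.
Qed.

Lemma mdeg_rim (m : mon) : vdeg m hub = 0%N ->
  mdeg m = (\sum_(i < p) (xdeg m (rim i) + ydeg m (rim (ordS i))))%N.
Proof.
move=> m_hub; rewrite mdeg_vdeg sum_wheel m_hub addn0 !big_split /=.
have <- : (\sum_(i < p) ydeg m (rim i) = \sum_(i < p) ydeg m (rim (ordS i)))%N.
  rewrite (reindex (@ordS p)) //; apply: onW_bij.
  by exists (@ord_pred p); [exact: ordSK|exact: ord_predK].
by rewrite -big_split; apply: eq_bigr => i _; rewrite ffunE.
Qed.

(** * Labels for the classes of a fixed degree *)

Section Degree.
Variable k : nat.

(** In order: standard monomials; classes supported on exactly the whole rim, with x-degree from 1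
    to k-1; classes with the hub, with x-degree from 0 to k. *)
Definition wheel_label :=
  (({g | g \in pair_labels p k} + {a | a \in full_labels p k} * 'I_k.-1) +
   {a | a \in pos_labels k hub} * 'I_k.+1)%type.

Definition has_wheel_label (d : wheel_label) (m : mon) : Prop :=
  match d with
  | inl (inl g) => vdeg m hub = 0%N /\
      forall i, xdeg m (rim i) = (val g i).1 /\ ydeg m (rim (ordS i)) = (val g i).2
  | inl (inr (a, s)) => [/\ vdeg m hub = 0, forall i, vdeg m (rim i) = val a i
      & \sum_i xdeg m i = s.+1]%N
  | inr (a, s) => (forall i, vdeg m i = val a i) /\ (\sum_i xdeg m i = s)%N
  end.

Lemma card_wheel_label : #|{: wheel_label}| =
  (#|pair_labels p k| + #|full_labels p k| * k.-1 + #|pos_labels k hub| * k.+1)%N.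
Proof. by rewrite !card_sum !card_prod !card_sig !card_ord. Qed.

Lemma pair_label_std g m : has_wheel_label (inl (inl g)) m -> std m.
Proof.
case=> m_hub mE; split=> // i; have [-> ->] := mE i.
have := valP g; rewrite inE => /andP[/forallP/(_ i)/orP[]/eqP->]; by [left|right].
Qed.

Lemma has_wheel_label_mdeg d m : has_wheel_label d m -> mdeg m = k.
Proof.
case: d => [[g|[a s]]|[a s]] /=.
- case=> /mdeg_rim -> mE; have := valP g; rewrite inE => /andP[_ /eqP <-].
  by apply: eq_bigr => i _; have [-> ->] := mE i.
- case=> m_hub mE _; rewrite mdeg_vdeg sum_wheel m_hub addn0.
  have := valP a; rewrite inE => /andP[_ /eqP <-].
  by apply: eq_bigr => i _; rewrite mE.
- case=> mE _; rewrite mdeg_vdeg; have := valP a; rewrite inE => /andP[_ /eqP <-].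
  by apply: eq_bigr => i _; rewrite mE.
Qed.

Lemma wheel_label_exists d : exists m, has_wheel_label d m.
Proof.
case: d => [[g|[a s]]|[a s]] /=.
- pose ext (f : 'I_p -> nat) (x : 'I_(p + 1)) := if split x is inl j then f j else 0%N.
  have ext_rim f j : ext f (rim j) = f j by rewrite /ext (unsplitK (inl j)).
  have ext_hub f : ext f hub = 0%N by rewrite /ext (unsplitK (inr ord0)).
  exists (mon_of (ext (fun i => (val g i).1)) (ext (fun i => (val g (ord_pred i)).2))).
  split=> [|i]; first by rewrite ffunE xdeg_mon_of ydeg_mon_of !ext_hub.
  by rewrite xdeg_mon_of ydeg_mon_of !ext_rim ordSK.
- pose v (x : 'I_(p + 1)) := if split x is inl j then (val a j : nat) else 0%N.
  have v_rim j : v (rim j) = val a j by rewrite /v (unsplitK (inl j)).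
  have v_hub : v hub = 0%N by rewrite /v (unsplitK (inr ord0)).
  have [|m mv ms] := @exists_mon _ v s.+1.
    rewrite sum_wheel v_hub addn0 (eq_bigr (fun j => val a j : nat)) //.
    have := valP a; rewrite inE => /andP[_ /eqP ->].
    by have := ltn_ord s; lia.
  by exists m; split=> // [|i]; rewrite mv.
- have [|m mv ms] := @exists_mon _ (fun i => val a i) s.
    have := valP a; rewrite inE => /andP[_ /eqP ->].
    by rewrite -ltnS.
  by exists m.
Qed.

Lemma std_wheel_label m : std m -> mdeg m = k ->
  exists d, forall m', has_wheel_label d m' -> m = m'.
Proof.
move=> sm mk; have [m_hub m_std] := sm.
pose g := [ffun i => (inord (xdeg m (rim i)), inord (ydeg m (rim (ordS i))))
  : 'I_k.+1 * 'I_k.+1].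
have g1 i : (g i).1 = xdeg m (rim i) :> nat.
  by rewrite ffunE inordK // ltnS -mk xdeg_le.
have g2 i : (g i).2 = ydeg m (rim (ordS i)) :> nat.
  by rewrite ffunE inordK // ltnS -mk ydeg_le.
have gP : g \in pair_labels p k.
  rewrite inE; apply/andP; split.
    apply/forallP => i; apply/orP.
    by case: (m_std i) => [x0|y0]; [left|right]; apply/eqP/val_inj; rewrite /= ?g1 ?g2.
  by rewrite -[eqbRHS]mk (mdeg_rim m_hub); apply/eqP/eq_bigr => i _; rewrite g1 g2.
exists (inl (inl (exist _ g gP))) => m' [m'_hub m'E].
have hub0 (u : mon) : vdeg u hub = 0%N -> xdeg u hub = 0%N /\ ydeg u hub = 0%N.
  by rewrite ffunE => /eqP; rewrite addn_eq0 => /andP[/eqP-> /eqP->].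
have [xh yh] := hub0 _ m_hub; have [xh' yh'] := hub0 _ m'_hub.
apply: mon_eq; apply: wheelP; rewrite ?xh ?xh' ?yh ?yh' // => i.
  by rewrite -g1; have [-> _] := m'E i.
by rewrite -(ord_predK i) -g2; have [_ ->] := m'E (ord_pred i).
Qed.

Lemma wheel_label_surj m : mdeg m = k ->
  exists d, forall m', has_wheel_label d m' -> label e m = label e m'.
Proof.
move=> mk; case: (posnP (vdeg m hub)) => [m_hub|m_hub]; last first.
  pose a := [ffun i => inord (vdeg m i) : 'I_k.+1].
  have aE i : a i = vdeg m i :> nat by rewrite ffunE inordK // ltnS -mk vdeg_le.
  have aP : a \in pos_labels k hub.
    rewrite inE aE m_hub -[eqbRHS]mk mdeg_vdeg; apply/eqP/eq_bigr => i _; exact: aE.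
  have sk : (\sum_i xdeg m i < k.+1)%N by rewrite ltnS -mk sum_xdeg_le.
  exists (inr (exist _ a aP, Ordinal sk)) => m' [/= m'v m's].
  apply: label_connected; [|by rewrite m's|by left].
  by apply/ffunP => i; rewrite m'v aE.
have of_std m1 : std m1 -> label e m = label e m1 ->
    exists d, forall m', has_wheel_label d m' -> label e m = label e m'.
  move=> sm1 lE; have [|d dE] := std_wheel_label sm1.
    by rewrite -mk !mdeg_vdeg (label_vdeg lE).
  by exists d => m' /dE <-.
case: (pickP (fun z => vdeg m (rim z) == 0%N)) => [z /eqP m_z|m_full].
  by have [m1 sm1 lE] := std_exists m_hub m_z; apply: of_std lE.
have {}m_full i : (0 < vdeg m (rim i))%N by rewrite lt0n m_full.
have sum0 (f : 'I_(p + 1) -> nat) : (\sum_i f i = 0 -> forall i, f i = 0)%N.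
  by move/eqP; rewrite sum_nat_eq0 => /forallP f0 i; apply/eqP/f0.
(* A hub-free monomial purely in y or purely in x is itself standard. *)
case: (posnP (\sum_i xdeg m i)%N) => [x0|x_gt0].
  apply: (of_std m) => //; split=> // i; left; exact: sum0 x0 _.
case: (posnP (\sum_i ydeg m i)%N) => [y0|y_gt0].
  apply: (of_std m) => //; split=> // i; right; exact: sum0 y0 _.
have mkxy : (k = \sum_i xdeg m i + \sum_i ydeg m i)%N.
  by rewrite -mk mdeg_vdeg -big_split; apply: eq_bigr => i _; rewrite ffunE.
pose a := [ffun i => inord (vdeg m (rim i)) : 'I_k.+1].
have aE i : a i = vdeg m (rim i) :> nat by rewrite ffunE inordK // ltnS -mk vdeg_le.
have aP : a \in full_labels p k.
  rewrite inE; apply/andP; split; first by apply/forallP => i; rewrite aE.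
  rewrite -[eqbRHS]mk mdeg_vdeg sum_wheel m_hub addn0.
  by apply/eqP/eq_bigr => i _; exact: aE.
(* Both total degrees are positive, so the x-degree lies between 1 and k-1; it is stored minus
   one. *)
have sk : ((\sum_i xdeg m i).-1 < k.-1)%N by lia.
exists (inl (inr (exist _ a aP, Ordinal sk))) => m' [/= m'_hub m'v m's].
apply: label_connected; [|by rewrite m's prednK|by right].
by apply/ffunP; apply: wheelP => [|i]; rewrite ?m_hub ?m'_hub // m'v aE.
Qed.

(** A standard monomial with full rim support is pure in x or in y, so its x-degree is [k] or 0; the
    other label has x-degree strictly between. *)
Lemma pair_full_label_neq g a s m m' :
  has_wheel_label (inl (inl g)) m -> has_wheel_label (inl (inr (a, s))) m' ->
  label e m <> label e m'.
Proof.
move=> gm am' lE; have sm := pair_label_std gm.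
have mk := has_wheel_label_mdeg gm; case: am' => m'_hub m'v m's.
have m_full i : (0 < vdeg m (rim i))%N.
  rewrite (label_vdeg lE) m'v.
  by have := valP a; rewrite inE => /andP[/forallP/(_ i)].
have := label_sum lE; rewrite m's => xs; have sk := ltn_ord s.
have hub0 : (xdeg m hub = 0 /\ ydeg m hub = 0)%N.
  by case: sm; rewrite ffunE => /eqP; rewrite addn_eq0 => /andP[/eqP-> /eqP->].
case: (std_full sm m_full) => z0.
  move: xs; rewrite sum_wheel hub0.1 big1 // => i _; exact: z0.
have xk : (\sum_i xdeg m i = k)%N.
  rewrite -mk mdeg_vdeg !sum_wheel !ffunE hub0.2 addn0; congr addn.
  by apply: eq_bigr => i _; rewrite ffunE z0 addn0.
by move: xs sk; rewrite xk; lia.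
Qed.

Lemma wheel_label_hub d m : has_wheel_label d m ->
  (vdeg m hub == 0%N) = (if d is inl _ then true else false).
Proof.
case: d => [[g|[a s]]|[a s]] /=; [by case=> ->|by case=> ->|].
case=> -> _; have := valP a; rewrite inE lt0n => /andP[/negPf-> _]; by [].
Qed.

Lemma wheel_label_inj d d' m m' : has_wheel_label d m -> has_wheel_label d' m' ->
  label e m = label e m' -> d = d'.
Proof.
move=> dm d'm' lE; have := wheel_label_hub dm.
rewrite (label_vdeg lE) (wheel_label_hub d'm').
have vE x : vdeg m x = vdeg m' x by rewrite (label_vdeg lE).
have sE := label_sum lE.
case: d dm => [[g|[a s]]|[a s]] dm; case: d' d'm' => [[g'|[a' s']]|[a' s']] d'm' //= _.
- have mm' := std_label_inj (pair_label_std dm) (pair_label_std d'm') lE.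
  congr (inl (inl _)); apply/val_inj/ffunP => i.
  case: dm d'm' => _ /(_ i)[g1 g2] [_ /(_ i)[g1' g2']].
  apply/eqP; rewrite -pair_eqE; apply/andP; split; apply/eqP/val_inj => /=.
    by rewrite -g1 -g1' mm'.
  by rewrite -g2 -g2' mm'.
- by case: (pair_full_label_neq dm d'm' lE).
- by case: (pair_full_label_neq d'm' dm (esym lE)).
- case: dm d'm' => _ av ss [_ av' ss']; congr (inl (inr (_, _))).
    by apply/val_inj/ffunP => i; apply/val_inj; rewrite /= -av -av' vE.
  by apply/val_inj; apply: succn_inj; rewrite -ss -ss'.
- case: dm d'm' => av ss [av' ss']; congr (inr (_, _)).
    by apply/val_inj/ffunP => i; apply/val_inj; rewrite /= -av -av' vE.
  by apply/val_inj; rewrite /= -ss -ss'.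
Qed.

Lemma wheel_has_dim (K : fieldType) : has_dim (@bei_quot_gr K (p + 1) e k)
  (#|pair_labels p k| + #|full_labels p k| * k.-1 + #|pos_labels k hub| * k.+1)%N.
Proof.
have [r rP] := fin_all_exists wheel_label_exists.
rewrite -card_wheel_label.
apply: (@has_dim_classes _ _ _ (@wheel_graph_sym p) _ _ r) => [d|m mk|d d' lE].
- exact: has_wheel_label_mdeg (rP d).
- by have [d dE] := wheel_label_surj mk; exists d; apply: dE.
- exact: wheel_label_inj (rP d) (rP d') lE.
Qed.
End Degree.

Lemma wheel_hilbert_series (K : fieldType) :
  let N1 : {poly int} :=
    (1 - 'X^2) * (1 + 'X) ^+ (p - 1) + (p - 1)%:R *: 'X^p + 'X^(p + 1) in
  let N2 : {poly int} := (p - 1)%:R *: 'X^2 + 2%:R *: 'X in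
  has_hilbert_series (@bei_quot_gr K (p + 1) e)
    (fun k => expand N1 ((1 - 'X) ^+ (p + 1)) k + expand N2 ((1 - 'X) ^+ (p + 2)) k).
Proof.
move=> N1 N2 k; eexists; first exact: wheel_has_dim.
by rewrite expand_wheel.
Qed.
End Wheel.

(** * Upper bound for chains of primes *)


(** Otherwise the coefficient matrix has more rows than columns, and a nonzero vector in its left
    kernel gives a linear relation. *)
Lemma indep_card (K : fieldType) (V : lmodType K) (I J : finType)
    (v : I -> V) (w : J -> V) :
    (forall i, exists c : J -> K, v i = \sum_j c j *: w j) ->
    (forall c : I -> K, \sum_i c i *: v i = 0 -> forall i, c i = 0) ->
  (#|I| <= #|J|)%N.
Proof.
move=> /fin_all_exists[c vE] v_free; rewrite leqNgt; apply/negP => ltJI.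
pose M := \matrix_(i < #|I|, j < #|J|) c (enum_val i) (enum_val j).
have : kermx M != 0.
  by rewrite -mxrank_eq0 mxrank_ker subn_eq0 -ltnNge (leq_ltn_trans (rank_leq_col M)).
case/rowV0Pn=> r /sub_kermxP rM /negP[]; apply/eqP/rowP => i; rewrite mxE.
rewrite -(enum_valK i); apply: (v_free (fun i => r 0 (enum_rank i))).
under eq_bigr do rewrite vE scaler_sumr.
rewrite exchange_big big1 //= => j _.
under eq_bigr do rewrite scalerA.
rewrite -scaler_suml (reindex_onto enum_val enum_rank) /=; last by move=> a _; apply: enum_rankK.
under eq_bigl do rewrite enum_valK eqxx.
have := congr1 (fun N : 'rV_#|J| => N 0 (enum_rank j)) rM; rewrite !mxE => rMj.
rewrite (eq_bigr (fun k => r 0 k * M k (enum_rank j))) ?rMj ?scale0r // => k _.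
by rewrite mxE !enum_rankK enum_valK.
Qed.

Section PrimeIdeal.
Variables (R : comNzRingType) (P : {pred R}).
Hypothesis Pprime : prime_ideal P.

Lemma prime_ideal0 : 0 \in P. Proof. by case: Pprime => -[]. Qed.
Lemma prime_ideal1 : 1 \notin P. Proof. by case: Pprime => -[]. Qed.
Lemma prime_idealDM a u v : u \in P -> v \in P -> a * u + v \in P.
Proof. by case: Pprime => -[_ _ PD] _; apply: PD. Qed.
Lemma prime_idealMr a u : u \in P -> a * u \in P.
Proof. by move=> uP; rewrite -[_ * _]addr0 prime_idealDM ?prime_ideal0. Qed.
Lemma prime_idealB u v : u + v \in P -> v \in P -> u \in P.
Proof.
move=> uvP vP; rewrite (_ : u = -1 * v + (u + v)) ?prime_idealDM //.
by rewrite mulN1r addrC addrK.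
Qed.
Lemma prime_idealP u v : u * v \in P -> u \in P \/ v \in P.
Proof. by case: Pprime => _ PM uv; apply/orP/PM. Qed.
End PrimeIdeal.

Section AlgebraicIndependence.
Variables (K : fieldType) (A : comAlgType K).

Definition indep_mod (P : {pred A}) (I : finType) (v : I -> A) :=
  forall c : I -> K, \sum_i c i *: v i \in P -> forall i, c i = 0.

(* Peel off the constant term: it lies in P1, hence vanishes, and f can then be
   cancelled modulo P0. *)
Lemma pow_sum_mod (P0 P1 : {pred A}) f k (g : nat -> A) :
    prime_ideal P0 -> prime_ideal P1 -> {subset P0 <= P1} ->
    f \in P1 -> f \notin P0 -> (forall j, g j \in P1 -> g j = 0) ->
  \sum_(j < k) f ^+ j * g j \in P0 -> forall j, (j < k)%N -> g j = 0.
Proof.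
move=> P0p P1p P01 fP1 fP0; elim: k g => // k IH g gP1.
rewrite big_ord_recl expr0 mul1r.
under eq_bigr do rewrite /= /bump /= add1n exprS -mulrA.
rewrite -mulr_sumr => gP0.
have g0 : g 0%N = 0.
  apply: gP1; apply: (prime_idealB P1p (P01 _ gP0)).
  by rewrite mulrC prime_idealMr.
move: gP0; rewrite g0 add0r => /(prime_idealP P0p)[fP|gP]; first by rewrite fP in fP0.
by case=> [_ //|j]; rewrite ltnS; apply: (IH (fun j => g j.+1)) => // j' /gP1.
Qed.

(** Grouped by powers of [f], the coefficients lie in the span of [v], which meets [P1] only in
    zero; hence [pow_sum_mod] applies. *)
Lemma indep_mod_pow (P0 P1 : {pred A}) f k (I : finType) (v : I -> A) :
    prime_ideal P0 -> prime_ideal P1 -> {subset P0 <= P1} ->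
    f \in P1 -> f \notin P0 -> indep_mod P1 v ->
  indep_mod P0 (fun ji : 'I_k * I => f ^+ ji.1 * v ji.2).
Proof.
move=> P0p P1p P01 fP1 fP0 vP1 c cP0 [j i].
case: k j c cP0 => [[]//|k] j c cP0.
pose g (j : nat) := \sum_i c (inord j, i) *: v i.
have gP1 l : g l \in P1 -> g l = 0.
  by move=> gl; rewrite /g big1 // => i' _; rewrite (vP1 _ gl) scale0r.
have : g j \in P1; last by move/vP1/(_ i); rewrite inord_val.
rewrite (pow_sum_mod (g := g) (k := k.+1) P0p P1p P01 fP1 fP0) ?prime_ideal0 //.
rewrite -[X in X \in _](_ : \sum_ji c ji *: (f ^+ ji.1 * v ji.2) = _) //.
rewrite (eq_bigr (fun ji => c (ji.1, ji.2) *: (f ^+ ji.1 * v ji.2))); last by case.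
rewrite -(pair_bigA _ (fun j i => c (j, i) *: (f ^+ j * v i))) /=.
apply: eq_bigr => l _; rewrite mulr_sumr; apply: eq_bigr => i' _.
by rewrite -scalerAr inord_val.
Qed.
End AlgebraicIndependence.

Section KrullUpper.
Variables (K : fieldType) (n : nat) (e : rel 'I_n).
Local Notation S := {mpoly K[n + n]}.
Local Notation Q := {ideal_quot (@bei K n e : idealr S)}.

(** The filtration by degree at most [D]: for a nonzero polynomial, [msize] is the degree plus
    one. *)
Definition quot_fil D (u : Q) := exists2 g : S, (msize g <= D.+1)%N & u = \pi_Q g.

Lemma quot_filM D D' u u' : quot_fil D u -> quot_fil D' u' -> quot_fil (D + D') (u * u').
Proof.
case=> [g gD ->] [g' g'D ->]; exists (g * g'); last by rewrite rmorphM.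
case: (eqVneq g 0) => [->|g0]; first by rewrite mul0r msize0.
case: (eqVneq g' 0) => [->|g'0]; first by rewrite mulr0 msize0.
rewrite msizeM //; move: gD g'D; move: (msize g) (msize g') => a b; lia.
Qed.

Lemma quot_fil1 D : quot_fil D 1.
Proof. by exists 1; rewrite ?rmorph1 // msize1. Qed.

Lemma quot_filS D D' u : (D <= D')%N -> quot_fil D u -> quot_fil D' u.
Proof. by move=> DD' [g gD ->]; exists g => //; apply: leq_trans gD _. Qed.

Lemma quot_filX D u k : quot_fil D u -> quot_fil (k * D) (u ^+ k).
Proof.
move=> uD; elim: k => [|k IH]; first exact: quot_fil1.
by rewrite exprS mulSn; apply: quot_filM.
Qed.

(** Each step of the chain supplies one [f], whose powers below [k] multiply the number of
    independent elements by [k] and raise the degrees by at most [k] times the size of a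
    representative. *)
Lemma prime_chain_indep m (P : nat -> {pred Q}) : prime_chain m P ->
  exists E, forall k, exists (I : finType) (v : I -> Q),
    [/\ #|I| = (k ^ m)%N, forall i, quot_fil (E * k) (v i) & indep_mod (P 0%N) v].
Proof.
elim: m P => [|m IH] P [Pp PS].
  exists 0%N => k; exists unit, (fun=> 1); split.
  - by rewrite card_unit.
  - by move=> _; apply: quot_fil1.
  - move=> c; rewrite (bigD1 tt) //= big1 => [|[]//]; rewrite addr0 => cP []; apply/eqP.
    apply: contraNT (prime_ideal1 (Pp 0%N isT)) => c0.
    have -> : 1 = (c tt)^-1%:A * (c tt *: 1) :> Q by rewrite -scalerAl mul1r scalerA mulVf ?scale1r.
    exact: (prime_idealMr (Pp 0%N isT)).
have [|E EP] := IH (fun i => P i.+1); first by split=> i im; [apply: Pp|apply: PS].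
have [P01 [f fP1 fP0]] := PS 0%N isT.
pose g := repr f; have fE : f = \pi_Q g by rewrite reprK.
exists (msize g + E)%N => k; have [I [v [Ik vE v_indep]]] := EP k.
exists ('I_k * I)%type, (fun ji : 'I_k * I => f ^+ ji.1 * v ji.2); split.
- by rewrite card_prod card_ord Ik expnS.
- move=> [j i] /=; rewrite mulnDl; apply: quot_filM => //.
  apply: (@quot_filS (j * msize g)); first by rewrite mulnC leq_mul2l (ltnW (ltn_ord j)) orbT.
  by apply: quot_filX; exists g.
- by apply: (@indep_mod_pow _ _ (P 0%N) (P 1%N)) => //; apply: Pp.
Qed.

Lemma quot_fil_span (d : nat -> nat) (b : forall j, 'I_(d j) -> Q) D u :
    (forall j v, @bei_quot_gr K n e j v <->
      exists c : 'I_(d j) -> K, v = \sum_i c i *: b j i) ->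
    quot_fil D u ->
  exists c : {j : 'I_D.+1 & 'I_(d j)} -> K,
    u = \sum_x c x *: b (tag x) (tagged x).
Proof.
move=> b_span [g gD ->].
pose h j := pihomog mdeg j g.
have gE : g = \sum_(j < D.+1) h j by apply: pihomog_partitionE.
have /fin_all_exists[c cE] : forall j : 'I_D.+1, exists c : 'I_(d j) -> K,
    \pi_Q (h j) = \sum_i c i *: b j i.
  by move=> j; apply/b_span; exists (h j) => //; apply: pihomogP.
exists (fun x => c (tag x) (tagged x)).
rewrite {1}gE raddf_sum /= -(sig_big_dep xpredT (fun _ => xpredT) (fun j i => c j i *: b j i)).
by apply: eq_bigr => j _; rewrite cE.
Qed.

Lemma prime_chain_le d (H : {poly int}) m (P : nat -> {pred Q}) :
    has_hilbert_series (@bei_quot_gr K n e) (expand H ((1 - 'X) ^+ d)) ->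
  prime_chain m P -> (m <= d)%N.
Proof.
move=> hs chP; have [E EP] := prime_chain_indep chP.
have [A HA] := expand_bound H d.
have /boolp.choice[dm dmP] : forall j, exists dj, has_dim (@bei_quot_gr K n e j) dj /\
    expand H ((1 - 'X) ^+ d) j = dj%:Z.
  by move=> j; have [dj] := hs j; exists dj.
(* The Hilbert function summed up to degree E k is a coefficient of H/(1-t)^(d+1), which
   [expand_bound] estimates. *)
have count k : (k ^ m <= A * (E * k).+1 ^ d)%N.
  have [I [v [Ik v_fil v_indep]]] := EP k.
  have [b bP] : exists b : forall j, 'I_(dm j) -> Q, forall j v,
      @bei_quot_gr K n e j v <-> exists c : 'I_(dm j) -> K, v = \sum_i c i *: b j i.
    have bP j : exists b : 'I_(dm j) -> Q, forall v,
        @bei_quot_gr K n e j v <-> exists c : 'I_(dm j) -> K, v = \sum_i c i *: b i.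
      by have [[b [_ bP]] _] := dmP j; exists b.
    by exists (fun j => projT1 (boolp.cid (bP j))) => j; apply: projT2 (boolp.cid (bP j)).
  have P0 : prime_ideal (P 0%N) by case: chP => + _; apply.
  have := indep_card (fun i => quot_fil_span bP (v_fil i)).
  rewrite Ik card_tagged => le_k.
  rewrite -lez_nat; apply: le_trans (HA (E * k)%N).
  rewrite -expand_psum; under eq_bigr do rewrite (dmP _).2.
  rewrite -(big_morph Posz PoszD (erefl _)) lez_nat.
  have -> : (\sum_(j < (E * k).+1) dm j)%N =
      sumn [seq #|'I_(dm j)| | j : 'I_(E * k).+1].
    by rewrite sumnE big_map big_enum; apply: eq_bigr => j _; rewrite card_ord.
  apply: le_k => c c0; apply: v_indep; rewrite c0.
  exact: prime_ideal0 P0.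
rewrite leqNgt; apply/negP => dm_lt.
(* If m > d, then E k + 1 <= (E+1) k turns the count into k^(d+1) <= A (E+1)^d k^d, which this [k]
   violates. *)
pose k := (A * E.+1 ^ d).+1.
have : (k ^ d.+1 <= A * E.+1 ^ d * k ^ d)%N.
  apply: leq_trans (leq_trans (count k) _); first by rewrite leq_pexp2l.
  rewrite -mulnA -expnMn leq_mul2l; apply/orP; right.
  by case: (d) => // d'; rewrite leq_exp2r // mulSn -[_.+1]add1n leq_add2r.
by rewrite expnS leq_pmul2r ?expn_gt0 // ltnn.
Qed.

End KrullUpper.

(** * A chain of primes *)


Section KrullLower.
Variables (K : fieldType) (n : nat) (e : rel 'I_n).
Local Notation S := {mpoly K[n + n]}.
Local Notation J := (@bei K n e).
Local Notation Q := {ideal_quot (@bei K n e : idealr S)}.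

Definition subst (h : 'I_(n + n) -> S) : S -> S :=
  comp_mpoly [tuple h i | i < n + n].
HB.instance Definition _ h := GRing.RMorphism.on (subst h).

Lemma substXU h i : subst h 'X_i = h i.
Proof. by rewrite /subst comp_mpolyXU -tnth_nth tnth_mktuple. Qed.

Lemma subst_subst h h' f : (forall i, subst h' (h i) = h' i) ->
  subst h' (subst h f) = subst h' f.
Proof.
move=> hh'; rewrite [f]mpolyE (rmorph_sum (subst h)) !(rmorph_sum (subst h')); apply: eq_bigr => m _.
rewrite /= /subst !comp_mpolyZ !comp_mpolyX rmorph_prod; congr (_ *: _).
apply: eq_bigr => i _; rewrite rmorphXn /= !tnth_mktuple.
by rewrite -[comp_mpoly _ _]/(subst h' (h i)) hh'.
Qed.

(** All 2-minors vanish, not only those of edges, so the kernel contains J for every graph. *)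
Definition edge_subst (h : 'I_(n + n) -> S) := forall i j,
  h (lshift n i) * h (rshift n j) = h (lshift n j) * h (rshift n i).

Lemma subst_bei h f : edge_subst h -> f \in J -> subst h f = 0.
Proof.
move=> hE /beiP[a ->]; rewrite rmorph_sum big1 // => i _.
rewrite rmorph_sum big1 // => j _.
by rewrite rmorphM rmorphB !rmorphM /= !substXU hE subrr mulr0.
Qed.

(** The kernel of the induced map from [Q] to [S]; under [edge_subst h] the chosen representative is
    immaterial, by [subst_kerE]. *)
Definition subst_ker h : {pred Q} := fun u => subst h (repr u) == 0.

Lemma subst_kerE h f : edge_subst h -> (\pi_Q f \in subst_ker h) = (subst h f == 0).
Proof.
move=> hE; rewrite /subst_ker unfold_in.
have : subst h (repr (\pi_Q f) - f) = 0.
  by apply: subst_bei => //; apply/pi_eqP; rewrite reprK.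
by rewrite rmorphB => /eqP; rewrite subr_eq0 => /eqP->.
Qed.

Lemma subst_ker_prime h : edge_subst h -> prime_ideal (subst_ker h).
Proof.
move=> hE; have kE f := subst_kerE f hE; split; first split.
- by rewrite -(rmorph0 \pi_Q) kE rmorph0.
- by rewrite -(rmorph1 \pi_Q) kE rmorph1 oner_eq0.
- move=> a u v; rewrite -[a]reprK -[u]reprK -[v]reprK -rmorphM -rmorphD !kE.
  by rewrite rmorphD rmorphM /= => /eqP-> /eqP->; rewrite mulr0 addr0.
- move=> u v; rewrite -[u]reprK -[v]reprK -rmorphM !kE rmorphM.
  by rewrite mulf_eq0.
Qed.

Lemma subst_ker_sub h h' : (forall i, subst h' (h i) = h' i) ->
  {subset subst_ker h <= subst_ker h'}.
Proof.
move=> hh' u; rewrite /subst_ker !unfold_in => /eqP u0.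
by rewrite -(subst_subst _ hh') u0 rmorph0.
Qed.

(* y_{i0} serves as the common ratio y_i / x_i, so that the kernel is the ideal
   of 2-minors, J_{K_n}. *)
Definition generic_subst (i0 : 'I_n) (l : 'I_(n + n)) : S :=
  match split l with
  | inl i => xvar K i
  | inr i => yvar K i0 * xvar K i
  end.

(** Its kernel is generated by all y and the x_i with i < j. *)
Definition special_subst (j : nat) (l : 'I_(n + n)) : S :=
  match split l with
  | inl i => if (j <= i)%N then xvar K i else 0
  | inr i => 0
  end.

Lemma split_cases (P : 'I_(n + n) -> Prop) :
  (forall i, P (lshift n i)) -> (forall i, P (rshift n i)) -> forall l, P l.
Proof. by move=> Pl Pr l; rewrite -(splitK l); case: (split l). Qed.

Lemma generic_substE i0 i : (generic_subst i0 (lshift n i) = xvar K i) *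
  (generic_subst i0 (rshift n i) = yvar K i0 * xvar K i).
Proof. by rewrite /generic_subst (unsplitK (inl i)) (unsplitK (inr i)). Qed.

Lemma special_substE j i :
  (special_subst j (lshift n i) = if (j <= i)%N then xvar K i else 0) *
  (special_subst j (rshift n i) = 0).
Proof. by rewrite /special_subst (unsplitK (inl i)) (unsplitK (inr i)). Qed.

Lemma prime_chain_bei : (0 < n)%N ->
  exists P : nat -> {pred Q}, prime_chain n.+1 P.
Proof.
move=> n_gt0; pose i0 := Ordinal n_gt0.
(* The kernel of [generic_subst], then those of [special_subst] for j = 0, ..., n: n+2 primes, hence
   length n+1. *)
pose P k := if k is j.+1 then subst_ker (special_subst j)
            else subst_ker (generic_subst i0).
have gE : edge_subst (generic_subst i0).
  by move=> i j; rewrite !generic_substE; ring.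
have sE j : edge_subst (special_subst j).
  by move=> i l; rewrite !special_substE !mulr0.
exists P; split=> [[|j] _|[|j] jn] /=; try exact: subst_ker_prime.
  split.
    apply: subst_ker_sub; apply: split_cases => i.
      by rewrite generic_substE special_substE substXU special_substE.
    by rewrite generic_substE special_substE rmorphM /= substXU special_substE mul0r.
  (* The generic substitution sends y_(i0) to y_(i0) x_(i0), which is nonzero, and the special one
     sends it to 0. *)
  exists (\pi_Q (yvar K i0)); rewrite subst_kerE // substXU.
    by rewrite special_substE.
  rewrite generic_substE mulf_eq0 /xvar /yvar -!msize_poly_eq0 !msizeX.
  by [].
split.
  apply: subst_ker_sub; apply: split_cases => i; rewrite !special_substE.
    case: (leqP j i) => ji; first by rewrite substXU special_substE.
    by rewrite ltnNge ltnW // rmorph0.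
  by rewrite rmorph0.
exists (\pi_Q (xvar K (Ordinal (jn : (j < n)%N)))); rewrite subst_kerE // substXU special_substE /=.
  by rewrite ltnn.
by rewrite leqnn /xvar -msize_poly_eq0 msizeX.
Qed.
End KrullLower.

(** * Hilbert series, dimension and multiplicity of the wheel *)

Theorem corollary4p7 (K : fieldType) (p : nat) (hp : (3 <= p)%N) :
  let N1 : {poly int} :=
    (1 - 'X^2) * (1 + 'X) ^+ (p - 1) + (p - 1)%:R *: 'X^p + 'X^(p + 1) in
  let N2 : {poly int} := (p - 1)%:R *: 'X^2 + 2%:R *: 'X in
  [/\ has_hilbert_series (@bei_quot_gr K (p + 1) (@wheel_graph p))
        (fun k => expand N1 ((1 - 'X) ^+ (p + 1)) k
                  + expand N2 ((1 - 'X) ^+ (p + 2)) k),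
      has_krull_dim (bei_quot K (@wheel_graph p)) (p + 2) &
      has_multiplicity (@bei_quot_gr K (p + 1) (@wheel_graph p)) (p + 1)%:Z].
Proof.
move=> N1 N2; have p_gt0 : (0 < p)%N by apply: leq_trans hp.
have hs := wheel_hilbert_series p_gt0 K; rewrite -/N1 -/N2 in hs.
have hs' : has_hilbert_series (@bei_quot_gr K (p + 1) (@wheel_graph p))
    (expand (N1 * (1 - 'X) + N2) ((1 - 'X) ^+ (p + 2))).
  by move=> k; have [d] := hs k; rewrite expand_wheel_merge; exists d.
have kd : has_krull_dim (bei_quot K (@wheel_graph p)) (p + 2).
  split; last by move=> m P; apply: prime_chain_le hs'.
  (* With n = p+1 vertices the chain has length n+1 = p+2. *)
  rewrite addn2 -(addn1 p); apply: prime_chain_bei; by rewrite addn1.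
split=> //; exists (p + 2)%N, (N1 * (1 - 'X) + N2); split=> //.
by rewrite wheel_multiplicity.
Qed.
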